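(* Let $p$ be a positive integer and $n\ge3$ an integer. Suppose there are integers $s_1,\dotsc,s_{n-1}>0$ and $t_1,\dotsc,t_{n-1}$ with $t_1,\dotsc,t_{n-2}>t_{n-1}=0$ such that $\sum_{i=1}^{n-1}s_i^k=\sum_{j=1}^{n-1}t_j^k$ for all $0\le k\le n-2$. Then there exists an $n$-dimensional (not necessarily convex) rational polytope $B_n\subset\mathbb{R}^n$ with period sequence $(1,\dotsc,1,p,1)$, i.e. $p_{n-1}=p$ and $p_i=1$ for $i\ne n-1$.
   Context: A convex rational polytope is the convex hull of finitely many points of $\mathbb{Q}^n$. A (not necessarily convex) rational polytope is a topological ball $\mathcal{B}\subset\mathbb{R}^n$ that is a union $\bigcup_{i\in I}\mathcal{P}_i$ of a finite family of convex rational polytopes, all with the same affine span, such that every nonempty intersection $\mathcal{P}_i\cap\mathcal{P}_j$, $i\ne j$, is a common facet of $\mathcal{P}_i$ and $\mathcal{P}_j$. For such an $n$-dimensional $\mathcal{B}\subset\mathbb{R}^n$ there are periodic functions $c_{\mathcal{B},i}\colon\mathbb{Z}\to\mathbb{Q}$ with finite periods such that $|k\mathcal{B}\cap\mathbb{Z}^n|=\sum_{i=0}^n c_{\mathcal{B},i}(k)k^i$ for all integers $k\ge1$; the period sequence is $(p_0,\dotsc,p_n)$ with $p_i$ the minimum period of $c_{\mathcal{B},i}$. *)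

(* Defs.v *)
From mathcomp Require Import all_boot all_order all_algebra.
From mathcomp Require Import all_classical all_reals topology normedtype.

Set Implicit Arguments.
Unset Strict Implicit.
Unset Printing Implicit Defensive.

Import Order.TTheory GRing.Theory Num.Theory.
Import numFieldNormedType.Exports.

Local Open Scope classical_set_scope.
Local Open Scope ring_scope.

Definition homeomorphic (T U : topologicalType) (A : set T) (B : set U) : Prop :=
  exists (f : T -> U) (g : U -> T),
    [/\ {within A, continuous f}, {within B, continuous g},
        (forall x, A x -> B (f x) /\ g (f x) = x)
      & (forall y, B y -> A (g y) /\ f (g y) = y)].

Section Polytopes.
Variables (R : realType) (n : nat).
Implicit Types (A B F P : set 'rV[R]_n).

(* The library norm on 'rV[R]_d is the sup norm, hence the explicit sum. *)
Definition closed_unit_ball d : set 'rV[R]_d :=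
  [set x | \sum_(i < d) x 0 i ^+ 2 <= 1].
Arguments closed_unit_ball : clear implicits.

Definition topological_ball (d : nat) A : Prop :=
  homeomorphic A (closed_unit_ball d).

Definition convex_hull A : set 'rV[R]_n :=
  [set x | exists (m : nat) (v : 'I_m -> 'rV[R]_n) (a : 'I_m -> R),
    [/\ forall i, A (v i), forall i, 0 <= a i, \sum_i a i = 1
      & x = \sum_i a i *: v i]].

Definition affine_span A : set 'rV[R]_n :=
  [set x | exists (m : nat) (v : 'I_m -> 'rV[R]_n) (a : 'I_m -> R),
    [/\ forall i, A (v i), \sum_i a i = 1 & x = \sum_i a i *: v i]].

(* The affine span is a translate of a d-dimensional linear subspace, given as
   the row space of M; the empty set has no dimension. *)
Definition has_dim A (d : nat) : Prop :=
  exists (x0 : 'rV[R]_n) (M : 'M[R]_(d, n)),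
    row_free M /\ affine_span A = [set x0 + u *m M | u in [set: 'rV[R]_d]].

Definition face F P : Prop :=
  exists (l : 'rV[R]_n) (b : R),
    (forall x, P x -> \sum_i l 0 i * x 0 i <= b) /\
    F = P `&` [set x | \sum_i l 0 i * x 0 i = b].

Definition facet F P : Prop :=
  face F P /\ exists d : nat, has_dim P d.+1 /\ has_dim F d.

Definition convex_rational_polytope P : Prop :=
  exists s : seq 'rV[rat]_n,
    P = convex_hull [set map_mx ratr q | q in [set` s]].

(* A d-dimensional, not necessarily convex, rational polytope. *)
Definition rational_polytope (d : nat) B : Prop :=
  [/\ topological_ball d B, has_dim B d
    & exists (m : nat) (P : 'I_m -> set 'rV[R]_n),
        [/\ B = \bigcup_i P i,
            forall i, convex_rational_polytope (P i),
            forall i j, affine_span (P i) = affine_span (P j)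
          & forall i j, i != j -> P i `&` P j !=set0 ->
              facet (P i `&` P j) (P i) /\ facet (P i `&` P j) (P j)]].

Definition dilate (k : nat) B : set 'rV[R]_n := [set k%:R *: x | x in B].

Definition integer_points : set 'rV[R]_n :=
  [set map_mx intr z | z in [set: 'rV[int]_n]].

Definition is_period (c : int -> rat) (q : nat) : Prop :=
  (0 < q)%N /\ forall k : int, c (k + q%:Z) = c k.

Definition minimum_period (c : int -> rat) (q : nat) : Prop :=
  is_period c q /\ forall q' : nat, is_period c q' -> (q <= q')%N.

(* c i is the coefficient function of k ^ i in the Ehrhart quasi-polynomial;
   being periodic, these functions are determined by B. *)
Definition ehrhart_coefficients B (c : 'I_n.+1 -> int -> rat) : Prop :=
  (forall i, exists q : nat, is_period (c i) q) /\
  forall k : nat, (0 < k)%N ->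
    exists N : nat, (dilate k B `&` integer_points #= `I_N)%card /\
      N%:R = \sum_(i < n.+1) c i k%:Z * k%:R ^+ i.

Definition has_period_sequence B (p : 'I_n.+1 -> nat) : Prop :=
  exists c : 'I_n.+1 -> int -> rat,
    ehrhart_coefficients B c /\ forall i, minimum_period (c i) (p i).

End Polytopes.

(* Main.v *)
Require Import Defs.
From mathcomp Require Import all_boot all_order all_algebra.
From mathcomp Require Import all_classical all_reals topology normedtype realfun.
From mathcomp Require Import ring lra zify.

(** Put y = x_0 and let all the horizontal slices of B be boxes
    [0 <= x_i <= l_i(y)], with l_i piecewise linear in y.  From bottom to top, B
    consists of T' x W, where T' is the box with sides t_1, ..., t_(n-2) and W is
    a polygon of height p; of a lattice frustum joining the top of T' x W to the
    box S with sides s_1, ..., s_(n-1); and of S x [0, 1/p].  The right-hand side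
    of W carries two triangular notches with apexes at abscissa 1/p, chosen so
    that W has a quadratic polynomial minus floor(k/p) lattice points.
    With L_S(k) = prod (s_i k + 1) and L_T(k) = prod (t_j k + 1), the k-th dilate
    of B thus has (L_S(k) - L_T(k)) floor(k/p) lattice points, up to a polynomial
    in k.  The equality of the power sums means, by Newton's identities, that
    L_S(k) - L_T(k) = A k^(n-1) with A <> 0, so only the coefficient of k^(n-1)
    is not constant, and it is a constant minus A (k mod p) / p.  For p = 1 a
    cube will do. *)

Set Implicit Arguments.
Unset Strict Implicit.
Unset Printing Implicit Defensive.

Import Order.TTheory GRing.Theory Num.Theory numFieldNormedType.Exports.

Local Open Scope classical_set_scope.
Local Open Scope ring_scope.

(** * Counting lattice points of the notched polygon *)

Lemma sum_ord_divn (q k : nat) (F : nat -> nat -> nat) :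
  (\sum_(y < q * k) F (y %/ q) (y %% q) = \sum_(a < k) \sum_(b < q) F a b)%N.
Proof.
elim: k => [|k IH]; first by rewrite muln0 !big_ord0.
rewrite big_ord_recr /= -IH mulnS addnC big_split_ord /=; congr (_ + _)%N.
apply: eq_bigr => b _; have := ltn_ord b; case: q b {IH} => [[]//|q] b lt_b.
by rewrite mulnC divnMDl // divn_small // addn0 modnMDl modn_small.
Qed.

(** Since max(a, b) = b + (a - b) with truncated subtraction, each notch contributes a sum of
    excesses: the lower one sums [k - v] over the [v] not congruent to [q] modulo [q.+1], the upper
    one over the multiples of [q.+1]. Exchanging the class of [q] for that of 0 shifts [v] by one,
    which costs exactly [k %/ q.+1]. *)
Lemma sum_notched_rows (q k : nat) : (0 < q)%N ->
  (\sum_(y < q * k) maxn (k - y) (y %/ q) + \sum_(u < k) maxn (k - q * u) u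
     + k %/ q.+1 = q.+2 * 'C(k, 2) + 2 * k)%N.
Proof.
move=> q_gt0.
have tri m : (\sum_(i < m) i = 'C(m, 2))%N by rewrite -bin2_sum big_mkord.
have rtri m : (\sum_(i < m) (m - i) = 'C(m.+1, 2))%N.
  rewrite -tri [RHS]big_ord_recl /= add0n (reindex_inj rev_ord_inj) /=.
  by apply: eq_bigr => i _; rewrite subKn // ltn_ord.
have E1 : (\sum_(y < q * k) maxn (k - y) (y %/ q) =
           q * 'C(k, 2) + \sum_(y < q * k) (k - (y + y %/ q)))%N.
  rewrite -tri big_distrr /=.
  have -> : (\sum_(i < k) q * i = \sum_(y < q * k) y %/ q)%N.
    rewrite (sum_ord_divn _ _ (fun a _ => a)); apply: eq_bigr => a _.
    by rewrite sum_nat_const card_ord.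
  by rewrite -big_split /=; apply: eq_bigr => y _; move: (y %/ q)%N => z; lia.
have E2 : (\sum_(u < k) maxn (k - q * u) u =
           'C(k, 2) + \sum_(u < k) (k - q.+1 * u))%N.
  by rewrite -tri -big_split /=; apply: eq_bigr => u _; rewrite mulSn; lia.
(* [y + y %/ q] enumerates the naturals not congruent to [q] modulo [q.+1]. *)
have E3 : (\sum_(y < q * k) (k - (y + y %/ q)) +
           \sum_(a < k) (k - (q.+1 * a + q)) = 'C(k.+1, 2))%N.
  transitivity (\sum_(v < q.+1 * k) (k - v))%N.
    transitivity (\sum_(v < q.+1 * k)
                   (k - (q.+1 * (v %/ q.+1) + v %% q.+1)))%N.
      rewrite (sum_ord_divn _ _ (fun a b => (k - (q.+1 * a + b))%N)).
      under [RHS]eq_bigr do rewrite big_ord_recr /=.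
      rewrite big_split /=; congr (_ + _)%N.
      transitivity (\sum_(y < q * k) (k - (q.+1 * (y %/ q) + y %% q)))%N.
        by apply: eq_bigr => y _; have := divn_eq y q; nia.
      by rewrite (sum_ord_divn _ _ (fun a b => (k - (q.+1 * a + b))%N)).
    by apply: eq_bigr => v _; rewrite mulnC -divn_eq.
  rewrite mulSn big_split_ord /= -[RHS]addn0 rtri; congr (_ + _)%N.
  by apply: big1 => i _; lia.
have E4 : (\sum_(u < k) (k - q.+1 * u) =
           k + \sum_(a < k) (k - q.+1 * a.+1))%N.
  (* The same sum of [k.+1] terms is split at its last term, which vanishes, and at its first, which
     is [k]. *)
  have: (\sum_(u < k.+1) (k - q.+1 * u) = \sum_(u < k.+1) (k - q.+1 * u))%N by [].
  rewrite [LHS]big_ord_recr [RHS]big_ord_recl /= muln0 subn0.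
  by have -> : (k - q.+1 * k = 0)%N by [nia]; rewrite addn0.
(* The two truncated differences differ by 1 exactly when [q.+1 * a.+1 <= k], that is for
   [k %/ q.+1] values of [a]. *)
have E5 : (\sum_(a < k) (k - (q.+1 * a + q)) =
           \sum_(a < k) (k - q.+1 * a.+1) + k %/ q.+1)%N.
  have -> : (k %/ q.+1 = \sum_(a < k) (q.+1 * a.+1 <= k)%N)%N.
    have count m : (m <= k)%N ->
        (\sum_(a < m) (q.+1 * a.+1 <= k)%N = minn m (k %/ q.+1))%N.
      elim: m => [|m IH] le_mk; first by rewrite big_ord0 min0n.
      rewrite big_ord_recr IH ?(ltnW le_mk) //= mulnC -leq_divRL //; lia.
    by rewrite count //; apply/esym/minn_idPr/leq_div.
  by rewrite -big_split /=; apply: eq_bigr => a _; nia.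
have := binS k 1; rewrite bin1; lia.
Qed.

(** * Polynomial functions *)

Definition polynomial_fun (m : nat) (f : nat -> rat) : Prop :=
  exists2 Q : {poly rat}, (size Q <= m.+1)%N & forall k, f k = Q.[k%:R].

Lemma polynomial_fun_ext m f g :
  f =1 g -> polynomial_fun m f -> polynomial_fun m g.
Proof. by move=> fg [Q sQ fQ]; exists Q => // k; rewrite -fg. Qed.

Lemma polynomial_funW m m' f :
  (m <= m')%N -> polynomial_fun m f -> polynomial_fun m' f.
Proof. by move=> le_m [Q sQ fQ]; exists Q => //; apply: leq_trans sQ _. Qed.

Lemma polynomial_fun_cst m c : polynomial_fun m (fun=> c).
Proof.
by exists c%:P => [|k]; rewrite ?hornerC // (leq_trans (size_polyC_leq1 _)).
Qed.

Lemma polynomial_fun_id : polynomial_fun 1 (fun k => k%:R).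
Proof. by exists 'X => [|k]; rewrite ?size_polyX ?hornerX. Qed.

Lemma polynomial_funD m f g : polynomial_fun m f -> polynomial_fun m g ->
  polynomial_fun m (fun k => f k + g k).
Proof.
move=> [Q sQ fQ] [P sP gP]; exists (Q + P) => [|k].
  by rewrite (leq_trans (size_polyD _ _)) // geq_max sQ.
by rewrite hornerD fQ gP.
Qed.

Lemma polynomial_funM m m' f g : polynomial_fun m f -> polynomial_fun m' g ->
  polynomial_fun (m + m') (fun k => f k * g k).
Proof.
move=> [Q sQ fQ] [P sP gP]; exists (Q * P) => [|k].
  by rewrite (leq_trans (size_polyMleq _ _)) //; lia.
by rewrite hornerM fQ gP.
Qed.

Lemma polynomial_funZ m c f :
  polynomial_fun m f -> polynomial_fun m (fun k => c * f k).
Proof. exact: (polynomial_funM (polynomial_fun_cst 0 c)). Qed.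

Lemma polynomial_funX m : polynomial_fun m (fun k => k%:R ^+ m).
Proof. by exists 'X^m => [|k]; rewrite ?size_polyXn ?hornerXn. Qed.

Lemma polynomial_fun_sum m I (r : seq I) (f : I -> nat -> rat) :
  (forall i, polynomial_fun m (f i)) ->
  polynomial_fun m (fun k => \sum_(i <- r) f i k).
Proof.
move=> pf; elim: r => [|i r IH].
  by apply: polynomial_fun_ext (polynomial_fun_cst m 0) => k; rewrite big_nil.
by apply: polynomial_fun_ext (polynomial_funD (pf i) IH) => k; rewrite big_cons.
Qed.

Lemma polynomial_fun_prod (I : finType) (f : I -> nat -> rat) :
  (forall i, polynomial_fun 1 (f i)) ->
  polynomial_fun #|I| (fun k => \prod_i f i k).
Proof.
move=> pf; rewrite cardE.
apply: (@polynomial_fun_ext _ (fun k => \prod_(i <- enum I) f i k)).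
  by move=> k; rewrite big_enum.
elim: (enum I) => [|i r IH].
  by apply: polynomial_fun_ext (polynomial_fun_cst 0 1) => k; rewrite big_nil.
by apply: polynomial_fun_ext (polynomial_funM (pf i) IH) => k; rewrite big_cons.
Qed.

Lemma polynomial_fun_sum_pow e :
  polynomial_fun e.+1 (fun k => \sum_(j < k) j%:R ^+ e).
Proof.
elim/ltn_ind: e => e IH.
(* [f] is the sum of [e]-th powers as solved from the identity [tele]; it involves smaller exponents
   only. *)
pose f k : rat := e.+1%:R^-1 *
  (k%:R ^+ e.+1 - \sum_(i < e) 'C(e.+1, i)%:R * \sum_(j < k) j%:R ^+ i).
have pf : polynomial_fun e.+1 f.
  apply/polynomial_funZ/polynomial_funD; first exact: polynomial_funX.
  apply: (@polynomial_fun_ext _ (fun k => -1 *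
    \sum_(i < e) 'C(e.+1, i)%:R * \sum_(j < k) j%:R ^+ i)).
    by move=> k; rewrite mulN1r.
  apply/polynomial_funZ/polynomial_fun_sum => i; apply: polynomial_funZ.
  exact: polynomial_funW (ltnW (ltn_ord i : (i.+1 < e.+1)%N)) (IH i (ltn_ord i)).
apply: polynomial_fun_ext pf => k; rewrite /f.
(* Telescoping [k ^ e.+1] and expanding [(j + 1) ^ e.+1] binomially. *)
have tele : k%:R ^+ e.+1 = \sum_(i < e.+1) 'C(e.+1, i)%:R *
    \sum_(j < k) (j%:R ^+ i : rat).
  have -> : k%:R ^+ e.+1 = \sum_(j < k) ((j.+1%:R : rat) ^+ e.+1 - j%:R ^+ e.+1).
    elim: k => [|k IHk]; first by rewrite big_ord0 expr0n.
    by rewrite big_ord_recr /= -IHk addrC subrK.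
  under eq_bigr => j _.
    rewrite -natr1 exprD1n big_ord_recr /= binn mulr1n addrK.
    under eq_bigr do rewrite -mulr_natl.
    over.
  by rewrite exchange_big; apply: eq_bigr => i _; rewrite mulr_sumr.
rewrite tele big_ord_recr /= addrAC subrr add0r mulrA binSn mulVf ?mul1r //.
by rewrite pnatr_eq0.
Qed.

(** The power [j%:R ^+ e] lets the induction on [r] close: multiplying out one factor yields [k]
    times the sum for [e], the sum for [e.+1] and the sum for [e] itself. *)
Lemma polynomial_fun_sum_prod_seq I (r : seq I) (a b : I -> rat) e :
  polynomial_fun (size r + e).+1
    (fun k => \sum_(j < k) (\prod_(i <- r) (a i * k%:R + b i * j%:R + 1)) * j%:R ^+ e).
Proof.
elim: r e => [|i r IH] e.
  apply: polynomial_fun_ext (polynomial_fun_sum_pow e) => k.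
  by apply: eq_bigr => j _; rewrite big_nil mul1r.
pose F e k : rat := \sum_(j < k)
  (\prod_(i <- r) (a i * k%:R + b i * j%:R + 1)) * j%:R ^+ e.
have F1 : polynomial_fun (size r + e).+2 (F e.+1) by rewrite -addnS; exact: IH.
have F2 : polynomial_fun (size r + e).+2 (fun k => a i * k%:R * F e k).
  exact: polynomial_funM (polynomial_funZ (a i) polynomial_fun_id) (IH e).
have F3 : polynomial_fun (size r + e).+2 (F e) by exact: polynomial_funW (IH e).
have := polynomial_funD (polynomial_funD F2 (polynomial_funZ (b i) F1)) F3.
apply: polynomial_fun_ext => k; rewrite /F !mulr_sumr -!big_split /=.
by apply: eq_bigr => j _; rewrite big_cons exprS; ring.
Qed.

(** Meant for the frustum, whose [j]-th row is a box with sides linear in [k] and [j]. *)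
Lemma polynomial_fun_sum_prod (I : finType) (a b : I -> rat) :
  polynomial_fun #|I|.+1
    (fun k => \sum_(j < k) \prod_i (a i * k%:R + b i * j%:R + 1)).
Proof.
have := polynomial_fun_sum_prod_seq (enum I) a b 0; rewrite addn0 -cardE.
by apply: polynomial_fun_ext => k; apply: eq_bigr => j _; rewrite mulr1 big_enum.
Qed.

(** * Newton's identities *)

(* Modulo ['X^m], the logarithmic derivative of
   [\prod_i (1 + s i X)] is the alternating generating series of the power sums. *)
Lemma deriv_prod_newton (F : comNzRingType) I (r : seq I) (s : I -> F) m :
  let P := \prod_(i <- r) (1 + s i *: 'X) in
  exists E : {poly F}, P^`() =
    P * (\sum_(l < m) ((-1) ^+ l * \sum_(i <- r) s i ^+ l.+1) *: 'X^l) + 'X^m * E.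
Proof.
elim: r => [|i r [E IH]] /=.
  exists 0; rewrite big_nil mul1r mulr0 addr0 -polyC1 derivC big1 // => l _.
  by rewrite big_nil mulr0 scale0r.
set P := \prod_(j <- r) _ in IH *; set D := \sum_(l < m) _ in IH.
(* [G] is the geometric series of s_i / (1 + s_i X) truncated below degree [m]; [GE] records the
   remainder. *)
pose G : {poly F} := \sum_(l < m) ((-1) ^+ l * s i ^+ l.+1) *: 'X^l.
have GE : (1 + s i *: 'X) * G = (s i)%:P - ((-1) ^+ m * s i ^+ m.+1) *: 'X^m.
  rewrite /G; elim: m {D IH E G} => [|m IHm].
    by rewrite big_ord0 mulr0 !expr0 mul1r expr1 alg_polyC subrr.
  rewrite big_ord_recr /= mulrDr IHm -!mul_polyC !exprS !polyCM.
  by rewrite polyCN polyC1; ring.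
exists ((1 + s i *: 'X) * E + (((-1) ^+ m * s i ^+ m.+1))%:P * P).
rewrite big_cons -/P.
have -> : \sum_(l < m) ((-1) ^+ l * \sum_(j <- i :: r) s j ^+ l.+1) *: 'X^l = G + D.
  rewrite -big_split; apply: eq_bigr => l _.
  by rewrite big_cons mulrDr scalerDl.
rewrite derivM IH derivD derivZ derivX -polyC1 derivC add0r polyC1 alg_polyC.
have -> : (s i)%:P = (1 + s i *: 'X) * G + ((-1) ^+ m * s i ^+ m.+1) *: 'X^m.
  by rewrite GE subrK.
by rewrite -!mul_polyC; ring.
Qed.

(** The difference [U] of the products satisfies U' = U D modulo X^m and U(0) = 0. The coefficient
    of X^j expresses (j + 1) U_(j+1) through U_0, ..., U_j, so all of them vanish by induction, in
    characteristic 0. *)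
Lemma prod_linear_coef_eq (I : Type) (r : seq I) (s t : I -> rat) m :
  (forall l, (1 <= l <= m)%N ->
     \sum_(i <- r) s i ^+ l = \sum_(i <- r) t i ^+ l) ->
  forall j, (j <= m)%N ->
  (\prod_(i <- r) (1 + s i *: 'X))`_j = (\prod_(i <- r) (1 + t i *: 'X))`_j.
Proof.
move=> st j le_jm.
have [E PE] := deriv_prod_newton r s m; have [E' PE'] := deriv_prod_newton r t m.
set P := \prod_(i <- r) _ in PE *; set P' := \prod_(i <- r) _ in PE' *.
set D := \sum_(l < m) _ in PE; move: PE'.
have <- : D = \sum_(l < m) ((-1) ^+ l * \sum_(i <- r) t i ^+ l.+1) *: 'X^l.
  by apply: eq_bigr => l _; rewrite st //= ltn_ord.
move=> PE'; pose U := P - P'.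
suff: U`_j = 0 by rewrite coefB => /eqP; rewrite subr_eq0 => /eqP.
have UE : U^`() = U * D + 'X^m * (E - E').
  by rewrite derivB PE PE' /U; ring.
have U0 : U`_0 = 0.
  rewrite -horner_coef0 hornerD hornerN !horner_prod.
  rewrite !big1 ?subrr // => i _;
    by rewrite hornerD hornerZ hornerX mulr0 addr0 hornerC.
clearbody U; elim/ltn_ind: j le_jm => -[//|j IH lt_jm].
have /(congr1 (fun Q : {poly rat} => Q`_j)) := UE.
rewrite coef_deriv coefD coefXnM lt_jm addr0 coefM big1 => [|i _]; last first.
  by rewrite IH ?mul0r // (leq_trans (ltnW (ltn_ord i))).
by move/eqP; rewrite mulrn_eq0 => /eqP.
Qed.

(** By Newton's identities the two products agree up to degree [d]. In degree [d.+1] the product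
    over [t] has no term, its last factor being 1, while that over [s] has the product of all the
    s_i as coefficient, which is [A]. *)
Lemma prod_linear_sub_monomial (d : nat) (s t : 'I_d.+1 -> rat) :
  (forall i, 0 < s i) -> t ord_max = 0 ->
  (forall l, (1 <= l <= d)%N -> \sum_i s i ^+ l = \sum_i t i ^+ l) ->
  exists2 A : rat, A != 0 & forall x : rat,
    \prod_i (s i * x + 1) - \prod_i (t i * x + 1) = A * x ^+ d.+1.
Proof.
move=> s_gt0 t0 st; pose P (u : 'I_d.+1 -> rat) : {poly rat} := \prod_i (1 + u i *: 'X).
have PE u x : (P u).[x] = \prod_i (u i * x + 1).
  rewrite horner_prod; apply: eq_bigr => i _.
  by rewrite hornerD hornerZ hornerX hornerC addrC.
have sz1 (c : rat) : (size (1 + c *: 'X : {poly rat})%R <= 2)%N.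
  rewrite (leq_trans (size_polyD _ _)) // size_poly1 geq_max /=.
  by rewrite (leq_trans (size_scale_leq _ _)) // size_polyX.
have szt : (size (P t) <= d.+1)%N.
  rewrite /P big_ord_recr /= t0 scale0r addr0 mulr1.
  apply: leq_trans (size_prod_leq _ _) _.
  rewrite card_ord leq_subLR (leq_ltn_trans (leq_sum _ (fun i _ => sz1 _))) //.
  by rewrite sum_nat_const card_ord; lia.
have szs : size (P s) = d.+2.
  have sz i : size (1 + s i *: 'X : {poly rat}) = 2.
    by rewrite addrC size_polyDl size_scale ?size_polyX ?size_poly1 // gt_eqF.
  rewrite size_prod => [|i _]; last by rewrite -size_poly_eq0 sz.
  by under eq_bigr do rewrite sz; rewrite sum_nat_const card_ord; lia.
have U : P s - P t = (P s)`_(d.+1) *: 'X^(d.+1).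
  apply/polyP => j; rewrite coefB coefZ coefXn.
  have [lt_jd|lt_dj|->] := ltngtP j d.+1.
  - rewrite mulr0; apply/eqP; rewrite subr_eq0; apply/eqP.
    exact: (@prod_linear_coef_eq _ _ s t d).
  - rewrite mulr0 [(P s)`__]nth_default ?szs // [(P t)`__]nth_default ?subrr //.
    by rewrite (leq_trans szt) // ltnW.
  - by rewrite [(P t)`__]nth_default // subr0 mulr1.
exists (P s)`_(d.+1) => [|x].
  have := lead_coef_eq0 (P s); rewrite lead_coefE szs => ->.
  by rewrite -size_poly_eq0 szs.
by rewrite -!PE -hornerN -hornerD U hornerZ hornerXn.
Qed.

(** * Homeomorphisms with the ball *)

Section Homeomorphisms.
Variable R : realType.

Lemma continuous_sum (T : topologicalType) (V : normedModType R) I (r : seq I)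
    (f : I -> T -> V) :
  (forall i, continuous (f i)) -> continuous (fun x => \sum_(i <- r) f i x).
Proof.
move=> cf x; elim: r => [|i r IH].
  by under eq_fun do rewrite big_nil; apply: cvg_cst.
under eq_fun do rewrite big_cons.
by apply: cvgD; [exact: cf|exact: IH].
Qed.

Lemma continuous_rV (T : topologicalType) n (f : T -> 'rV[R]_n) :
  (forall i, continuous (fun x => f x 0 i)) -> continuous f.
Proof.
move=> cf.
have -> : f = (fun x => \sum_i f x 0 i *: delta_mx 0 i).
  by apply/funext => x; exact: row_sum_delta.
apply: continuous_sum => i x; apply: cvgZ; [exact: cf|exact: cvg_cst].
Qed.

Lemma continuousZ_div (T : topologicalType) (V : normedModType R)
    (f g : T -> R) (h : T -> V) (x : T) :
  {for x, continuous f} -> {for x, continuous g} -> g x != 0 ->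
  {for x, continuous h} -> {for x, continuous (fun y => (f y / g y) *: h y)}.
Proof.
by move=> cf cg gx0 ch; apply: cvgZ => //; apply: cvgM => //; apply: cvgV.
Qed.

Lemma continuous_at_dominated (T : topologicalType) (V : normedModType R)
    (f : T -> V) (g : T -> R) (x : T) :
  {for x, continuous g} -> g x = 0 -> f x = 0 -> (forall y, `|f y| <= g y) ->
  {for x, continuous f}.
Proof.
move=> cg gx0 fx0 le_fg; rewrite /prop_for /continuous_at fx0.
apply/cvgrPdist_lt => e e_gt0; have /cvgrPdist_lt/(_ e e_gt0) := cg.
apply: filterS => y; rewrite gx0 !sub0r !normrN; apply: le_lt_trans.
exact: le_trans (le_fg y) (ler_norm _).
Qed.

(** Maps continuous on the whole space compose without recourse to subspace topologies. *)
Definition globally_homeomorphic (T U : topologicalType) (A : set T) (B : set U) :=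
  exists (f : T -> U) (g : U -> T),
    [/\ continuous f, continuous g,
        (forall x, A x -> B (f x) /\ g (f x) = x)
      & (forall y, B y -> A (g y) /\ f (g y) = y)].

Lemma globally_homeomorphic_trans (T U V : topologicalType) (A : set T)
    (B : set U) (C : set V) :
  globally_homeomorphic A B -> globally_homeomorphic B C ->
  globally_homeomorphic A C.
Proof.
move=> [f [g [cf cg fP gP]]] [f' [g' [cf' cg' fP' gP']]].
exists (f' \o f), (g \o g'); split.
- by move=> x; apply: continuous_comp; [exact: cf|exact: cf'].
- by move=> x; apply: continuous_comp; [exact: cg'|exact: cg].
- by move=> x /fP[/fP'[? e] ?] /=; rewrite e.
- by move=> x /gP'[/gP[? e] ?] /=; rewrite e.
Qed.

Lemma globally_homeomorphic_homeomorphic (T U : topologicalType) (A : set T)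
    (B : set U) :
  globally_homeomorphic A B -> homeomorphic A B.
Proof.
by move=> [f [g [cf cg fP gP]]]; exists f, g; split=> //; exact: continuous_subspaceT.
Qed.

Section Radial.
Variable n : nat.
Implicit Types (x : 'rV[R]_n) (phi psi : 'rV[R]_n -> R).

(** The third condition makes [phi] positive off the origin and controls [radial] near it. The sup
    norm and the Euclidean norm are the instances of interest. *)
Definition gauge_like phi :=
  [/\ continuous phi, (forall c x, 0 <= c -> phi (c *: x) = c * phi x)
    & forall x, `|x| <= phi x].

(* At [x = 0] the factor is [0 / 0 = 0], which is harmless. *)
Definition radial phi psi x := (phi x / psi x) *: x.

Lemma gauge_like_ge0 phi x : gauge_like phi -> 0 <= phi x.
Proof. by case=> _ _ /(_ x); apply: le_trans. Qed.

Lemma gauge_like_gt0 phi x : gauge_like phi -> x != 0 -> 0 < phi x.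
Proof. by case=> _ _ /(_ x) + x0; apply: lt_le_trans; rewrite normr_gt0. Qed.

Lemma gauge_like0 phi : gauge_like phi -> phi 0 = 0.
Proof. by case=> _ h _; rewrite -(scale0r 0) h // mul0r. Qed.

(** Off the origin the scaling factor is a quotient with nonzero denominator. At the origin,
    [|y| <= psi y] gives [|radial phi psi y| <= phi y], which tends to 0. *)
Lemma radial_continuous phi psi :
  gauge_like phi -> gauge_like psi -> continuous (radial phi psi).
Proof.
move=> gphi gpsi x; have [cphi _ _] := gphi; have [cpsi _ lepsi] := gpsi.
have [->|x0] := eqVneq x 0; last first.
  have psi_neq0 : psi x != 0 by rewrite gt_eqF // gauge_like_gt0.
  exact: continuousZ_div (cphi x) (cpsi x) psi_neq0 (fun _ => id).
apply: (continuous_at_dominated (cphi 0)); rewrite /radial ?gauge_like0 ?scaler0 //.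
move=> y; have [->|y0] := eqVneq y 0; first by rewrite scaler0 normr0 gauge_like0.
have psi_gt0 := gauge_like_gt0 gpsi y0.
rewrite normrZ normrM normfV (gtr0_norm psi_gt0) (ger0_norm (gauge_like_ge0 y gphi)).
rewrite -mulrA ler_piMr ?gauge_like_ge0 //.
by rewrite mulrC ler_pdivrMr // mul1r.
Qed.

(** On each ray, [radial phi psi] carries the point of [phi]-level c to that of [psi]-level c, so
    exchanging the roles inverts it. *)
Lemma radialK phi psi x : gauge_like phi -> gauge_like psi ->
  psi (radial phi psi x) = phi x /\ radial psi phi (radial phi psi x) = x.
Proof.
move=> gphi gpsi; have [_ hphi _] := gphi; have [_ hpsi _] := gpsi.
have [->|x0] := eqVneq x 0.
  by rewrite /radial !scaler0 !gauge_like0.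
have phi_gt0 := gauge_like_gt0 gphi x0; have psi_gt0 := gauge_like_gt0 gpsi x0.
have c_ge0 : 0 <= phi x / psi x by rewrite divr_ge0 ?ltW.
have psiE : psi (radial phi psi x) = phi x by rewrite hpsi //; field; lra.
split=> //; rewrite {1}/radial psiE hphi // scalerA -[RHS]scale1r.
by congr (_ *: _); field; lra.
Qed.

Lemma gauge_balls_homeomorphic phi psi : gauge_like phi -> gauge_like psi ->
  globally_homeomorphic [set x | phi x <= 1] [set x | psi x <= 1].
Proof.
move=> gphi gpsi; exists (radial phi psi), (radial psi phi); split.
- exact: radial_continuous.
- exact: radial_continuous.
- by move=> x /= le1; have [-> ->] := radialK x gphi gpsi.
- by move=> x /= le1; have [-> ->] := radialK x gpsi gphi.
Qed.

Lemma mx_norm_le x (c : R) : 0 <= c -> (`|x| <= c) = [forall i, `|x 0 i| <= c].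
Proof.
move=> c_ge0; rewrite [`|x|](mx_normrE x).
apply/idP/forallP => [le_c i|le_c].
  apply: le_trans le_c.
  exact: (le_bigmax 0 (fun ij : 'I_1 * 'I_n => `|x ij.1 ij.2|) (0, i)).
by apply: bigmax_le => // -[i j] _ /=; rewrite ord1.
Qed.

Lemma gauge_like_norm : gauge_like (fun x => `|x|).
Proof.
split=> [|c x c_ge0|//]; first exact: norm_continuous.
by rewrite normrZ ger0_norm.
Qed.

Lemma gauge_like_euclidean :
  gauge_like (fun x => Num.sqrt (\sum_i x 0 i ^+ 2)).
Proof.
split=> [x|c x c_ge0|x].
- apply: continuous_comp; last exact: sqrt_continuous.
  apply: continuous_sum => i y.
  apply: (@continuous_comp _ _ _ (fun z : 'rV[R]_n => z 0 i) (fun a => a ^+ 2)).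
    exact: coord_continuous.
  exact: exprn_continuous.
- under eq_bigr do rewrite mxE exprMn.
  by rewrite -mulr_sumr sqrtrM ?sqr_ge0 // sqrtr_sqr ger0_norm.
- rewrite mx_norm_le ?sqrtr_ge0 //; apply/forallP => i.
  rewrite -sqrtr_sqr ler_sqrt ?sumr_ge0 // => [|j _]; last exact: sqr_ge0.
  by rewrite (bigD1 i) //= lerDl sumr_ge0 // => j _; exact: sqr_ge0.
Qed.

Lemma cube_ball_homeomorphic :
  globally_homeomorphic [set x : 'rV[R]_n | `|x| <= 1] (@closed_unit_ball R n).
Proof.
suff -> : @closed_unit_ball R n =
    [set x : 'rV[R]_n | Num.sqrt (\sum_i x 0 i ^+ 2) <= 1].
  exact: gauge_balls_homeomorphic gauge_like_norm gauge_like_euclidean.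
apply/funext => x; apply/propext; rewrite /closed_unit_ball /=.
by rewrite -[X in _ <-> is_true (_ <= X)]sqrtr1 ler_sqrt.
Qed.

End Radial.
End Homeomorphisms.

(** * Towers of boxes *)

Section RowCons.
Variables (T : Type) (d : nat).

(** Coordinate 0 serves as the height, the others as coordinates in the horizontal slice. *)
Definition row_cons (y : T) (x : 'I_d -> T) : 'rV[T]_d.+1 :=
  \row_j (if unlift ord0 j is Some i then x i else y).

Lemma row_cons0 y x : row_cons y x 0 ord0 = y.
Proof. by rewrite mxE unlift_none. Qed.

Lemma row_consS y x i : row_cons y x 0 (lift ord0 i) = x i.
Proof. by rewrite mxE liftK. Qed.

Lemma row_consP (v : 'rV[T]_d.+1) y x :
  v 0 ord0 = y -> (forall i, v 0 (lift ord0 i) = x i) -> row_cons y x = v.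
Proof.
move=> v0 vS; apply/rowP => j.
by case: (unliftP ord0 j) => [i|] ->; rewrite ?row_cons0 ?row_consS.
Qed.

End RowCons.

Lemma map_row_cons (T U : Type) (f : T -> U) d y (x : 'I_d -> T) :
  map_mx f (row_cons y x) = row_cons (f y) (f \o x).
Proof.
by apply/esym/row_consP => [|i]; rewrite mxE ?row_cons0 ?row_consS.
Qed.

Section Towers.
Variables (R : realType) (d : nat).
Implicit Types (v w : 'rV[R]_d.+1) (a b h : R) (l : 'I_d -> R -> R).

Definition tower a b l : set 'rV[R]_d.+1 :=
  [set v | a <= v 0 ord0 <= b /\
           forall i, 0 <= v 0 (lift ord0 i) <= l i (v 0 ord0)].

Lemma continuous_row_cons (T : topologicalType) (y : T -> R) (x : 'I_d -> T -> R) :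
  continuous y -> (forall i, continuous (x i)) ->
  continuous (fun t => row_cons (y t) (x ^~ t)).
Proof.
move=> cy cx; apply: continuous_rV => j.
have [i ->|->] := unliftP ord0 j.
  by under eq_fun do rewrite row_consS; exact: cx.
by under eq_fun do rewrite row_cons0.
Qed.

(** Height and slice coordinates are rescaled affinely to [-1, 1], the latter by the width at their
    height. Positivity of [l] at all heights makes both maps continuous everywhere. *)
Lemma tower_cube_homeomorphic h l : 0 < h ->
  (forall i, continuous (l i)) -> (forall i y, 0 < l i y) ->
  globally_homeomorphic (tower 0 h l) [set x : 'rV[R]_d.+1 | `|x| <= 1].
Proof.
move=> h_gt0 cl l_gt0.
pose f v := row_cons (2 * v 0 ord0 / h - 1)
  (fun i => 2 * v 0 (lift ord0 i) / l i (v 0 ord0) - 1).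
pose ht v := h * (v 0 ord0 + 1) / 2.
pose g v := row_cons (ht v) (fun i => l i (ht v) * (v 0 (lift ord0 i) + 1) / 2).
have cc j : continuous (fun v : 'rV[R]_d.+1 => v 0 j) by exact: coord_continuous.
have cD (u w : 'rV[R]_d.+1 -> R) : continuous u -> continuous w ->
    continuous (fun v => u v + w v).
  by move=> cu cw v; apply: continuousD; [exact: cu|exact: cw].
have cM (u w : 'rV[R]_d.+1 -> R) : continuous u -> continuous w ->
    continuous (fun v => u v * w v).
  by move=> cu cw v; apply: continuousM; [exact: cu|exact: cw].
have cC (c : R) : continuous (fun _ : 'rV[R]_d.+1 => c) by exact: cst_continuous.
have cll (u : 'rV[R]_d.+1 -> R) i : continuous u -> continuous (fun v => l i (u v)).
  by move=> cu v; apply: (@continuous_comp _ _ _ u (l i)); [exact: cu|exact: cl].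
have cht : continuous ht.
  by apply: (cM _ _ (cM _ _ (cC h) (cD _ _ (cc _) (cC 1))) (cC _)).
exists f, g; split.
- apply: continuous_row_cons => [|i].
    exact: cD _ _ (cM _ _ (cM _ _ (cC 2) (cc _)) (cC _)) (cC _).
  apply: (cD _ _ (cM _ _ (cM _ _ (cC 2) (cc _)) _) (cC _)).
  by move=> v; apply: continuousV; [rewrite gt_eqF|exact: cll].
- apply: continuous_row_cons => // i.
  exact: cM _ _ (cM _ _ (cll _ _ cht) (cD _ _ (cc _) (cC 1))) (cC _).
- move=> v [/andP[v0 vh] vl]; split.
    rewrite /= mx_norm_le //; apply/forallP => j.
    have [i ->|->] := unliftP ord0 j; rewrite ?row_consS ?row_cons0 ler_norml.
      have /andP[vi0 vil] := vl i; have li := l_gt0 i (v 0 ord0).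
      set z := _ / _; suff: 0 <= z <= 2 by lra.
      rewrite /z ler_pdivrMr //; apply/andP; split; last by lra.
      by rewrite divr_ge0 ?mulr_ge0 // ltW.
    set z := _ / _; suff: 0 <= z <= 2 by lra.
    rewrite /z ler_pdivrMr //; apply/andP; split; last by lra.
      by rewrite divr_ge0 ?mulr_ge0 // ltW.
  have htE : ht (f v) = v 0 ord0 by rewrite /ht row_cons0; field; lra.
  apply: row_consP => [|i]; rewrite htE // row_consS.
  by field; rewrite gt_eqF.
- move=> v /=; rewrite mx_norm_le // => /forallP v1.
  have b j : -1 <= v 0 j <= 1 by have := v1 j; rewrite ler_norml.
  split.
    split=> [|i]; rewrite ?row_consS row_cons0.
      by have := b ord0; rewrite /ht; nra.
    by have := b (lift ord0 i); have := l_gt0 i (ht v); nra.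
  apply: row_consP => [|i]; rewrite row_cons0 /ht; first by field; lra.
  by rewrite row_consS -/(ht v); field; rewrite gt_eqF.
Qed.

Lemma tower_topological_ball h l : 0 < h ->
  (forall i, continuous (l i)) -> (forall i y, 0 < l i y) ->
  topological_ball d.+1 (tower 0 h l).
Proof.
move=> h_gt0 cl l_gt0; apply: globally_homeomorphic_homeomorphic.
apply: globally_homeomorphic_trans (cube_ball_homeomorphic _ _).
exact: tower_cube_homeomorphic.
Qed.

End Towers.

(** * Affine spans, dimensions and facets of towers *)

Section AffineSpans.
Variables (R : realType) (n : nat).
Implicit Types (A B : set 'rV[R]_n).

Lemma convex_hull_fin A (T : finType) (v : T -> 'rV[R]_n) (a : T -> R) :
  (forall t, A (v t)) -> (forall t, 0 <= a t) -> \sum_t a t = 1 ->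
  convex_hull A (\sum_t a t *: v t).
Proof.
move=> Av a_ge0 a1; exists #|T|, (fun i => v (enum_val i)), (fun i => a (enum_val i)).
have sumE (V : nmodType) (F : T -> V) : \sum_t F t = \sum_(i < #|T|) F (enum_val i).
  by rewrite (reindex (@enum_val T T)) //; exact/onW_bij/enum_val_bij.
by split=> //; [rewrite -a1 sumE|rewrite sumE].
Qed.

(** The [b j] are the affine coordinates of [x] relative to [c] and the points on the axes through
    [c]. An entry [e j = 0] freezes coordinate [j], so that towers and their horizontal slices are
    both covered. *)
Lemma affine_span_axes A (c : 'rV[R]_n) (e : 'I_n -> R) :
  A c -> (forall j, A (c + e j *: delta_mx 0 j)) ->
  forall x : 'rV[R]_n, (forall j, e j = 0 -> x 0 j = c 0 j) -> affine_span A x.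
Proof.
move=> Ac Ae x xc; pose b j := (x 0 j - c 0 j) / e j.
exists n.+1, (fun i => if unlift ord0 i is Some j then c + e j *: delta_mx 0 j else c),
  (fun i => if unlift ord0 i is Some j then b j else 1 - \sum_j b j); split.
- by move=> i; case: unliftP.
- rewrite big_ord_recl unlift_none; under [X in _ + X = _]eq_bigr do rewrite liftK.
  by rewrite subrK.
- rewrite big_ord_recl unlift_none.
  under [X in _ = _ + X]eq_bigr do rewrite liftK scalerDr scalerA.
  rewrite big_split /= -scaler_suml addrA -scalerDl subrK scale1r.
  rewrite [LHS]row_sum_delta {1}[c]row_sum_delta -big_split; apply: eq_bigr => j _.
  rewrite /= -scalerDl; congr (_ *: _); have [e0|e_neq0] := eqVneq (e j) 0.
    by rewrite e0 mulr0 addr0 xc.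
  by rewrite /b divfK // addrC subrK.
Qed.

Lemma has_dim_setT A : affine_span A = setT -> has_dim A n.
Proof.
move=> spanA; exists 0, 1%:M; rewrite spanA row_free_unit unitmx1; split=> //.
by apply/seteqP; split=> x // _; exists x; rewrite // mulmx1 add0r.
Qed.

End AffineSpans.

Section TowerPieces.
Variables (R : realType) (d : nat).
Implicit Types (v w : 'rV[R]_d.+1) (a b h : R) (l : 'I_d -> R -> R).

Lemma row_cons_add0 y x (c : R) :
  row_cons y x + c *: delta_mx 0 ord0 = row_cons (y + c) x :> 'rV[R]_d.+1.
Proof.
apply/esym/row_consP => [|i]; rewrite !mxE ?unlift_none ?liftK ?eqxx /= ?mulr1 //.
by rewrite mulr0 addr0.
Qed.

Lemma row_cons_addS y x (c : R) i :
  row_cons y x + c *: delta_mx 0 (lift ord0 i) =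
  row_cons y (fun j => x j + c * (j == i)%:R) :> 'rV[R]_d.+1.
Proof.
apply/esym/row_consP => [|j]; rewrite !mxE ?unlift_none ?liftK.
  by rewrite /= mulr0 addr0.
by rewrite eqxx (inj_eq (@lift_inj _ ord0)).
Qed.

Lemma affine_span_tower a b l : a < b -> (forall i y, 0 < l i y) ->
  affine_span (tower a b l) = setT.
Proof.
move=> lt_ab l_gt0; apply/seteqP; split=> // x _.
(* Moves from a corner of the slice at height [b]: to the adjacent corners of that slice, and
   straight down to height [a]. *)
pose e j := if unlift ord0 j is Some i then l i b else a - b.
apply: (@affine_span_axes _ _ _ (row_cons b (fun=> 0)) e) => [|j|j].
- by split=> [|i]; rewrite ?row_consS row_cons0 ?lexx ?ltW.
- rewrite /e; case: unliftP => [i|] ->.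
    rewrite row_cons_addS; split=> [|k]; rewrite ?row_consS row_cons0;
      first by rewrite lexx ?ltW.
    have := l_gt0 i b; have := l_gt0 k b; rewrite add0r.
    by case: eqVneq => [->|_]; rewrite /= ?mulr1 ?mulr0; lra.
  rewrite row_cons_add0 addrC subrK.
  by split=> [|i]; rewrite ?row_consS row_cons0 ?lexx ?ltW.
- rewrite /e; case: unliftP => [i|] _ e0; first by have := l_gt0 i b; rewrite e0 ltxx.
  by move: lt_ab; rewrite -subr_lt0 e0 ltxx.
Qed.

Lemma affine_span_slice b l : (forall i y, 0 < l i y) ->
  affine_span (tower b b l) = [set v | v 0 ord0 = b].
Proof.
move=> l_gt0; apply/seteqP; split=> x.
  move=> [m [v [c [Av c1 ->]]]] /=; rewrite summxE.
  under eq_bigr => i _.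
    rewrite mxE; have [/le_anti <- _] := Av i.
    over.
  by rewrite -mulr_suml c1 mul1r.
move=> /= xb; pose e j := if unlift ord0 j is Some i then l i b else 0.
apply: (@affine_span_axes _ _ _ (row_cons b (fun=> 0)) e) => [|j|j].
- by split=> [|i]; rewrite ?row_consS row_cons0 ?lexx ?ltW.
- rewrite /e; case: unliftP => [i|] ->; last first.
    by rewrite scale0r addr0; split=> [|i]; rewrite ?row_consS row_cons0 ?lexx ?ltW.
  rewrite row_cons_addS; split=> [|k]; rewrite ?row_consS row_cons0;
      first by rewrite lexx ?ltW.
  have := l_gt0 i b; have := l_gt0 k b; rewrite add0r.
  by case: eqVneq => [->|_]; rewrite /= ?mulr1 ?mulr0; lra.
- rewrite /e; case: unliftP => [i|] -> e0; last by rewrite row_cons0.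
  by have := l_gt0 i b; rewrite e0 ltxx.
Qed.

Lemma has_dim_slice b l : (forall i y, 0 < l i y) -> has_dim (tower b b l) d.
Proof.
move=> l_gt0; rewrite /has_dim affine_span_slice //.
pose M : 'M[R]_(d, d.+1) := \matrix_(i, j) (j == lift ord0 i)%:R.
have uM (u : 'rV[R]_d) : u *m M = row_cons 0 (fun i => u 0 i).
  apply/esym/row_consP => [|i]; rewrite mxE.
    by apply: big1 => i _; rewrite mxE mulr0.
  rewrite (bigD1 i) //= mxE eqxx mulr1 big1 ?addr0 // => j /negbTE ne_ji.
  by rewrite mxE (inj_eq (@lift_inj _ ord0)) eq_sym ne_ji mulr0.
exists (row_cons b (fun=> 0)), M; split.
  apply/row_freeP; exists M^T; apply/matrixP => i j.
  rewrite mxE big_ord_recl !mxE mul0r add0r (bigD1 i) //= !mxE eqxx mul1r.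
  rewrite (inj_eq (@lift_inj _ ord0)) big1 ?addr0 // => k ne_ki.
  by rewrite !mxE (inj_eq (@lift_inj _ ord0)) (negbTE ne_ki) mul0r.
apply/seteqP; split=> [v /= v0|_ [u _ <-] /=].
  exists (\row_i v 0 (lift ord0 i)) => //; rewrite uM.
  apply/rowP => j; case: (unliftP ord0 j) => [i|] ->.
    by rewrite mxE !row_consS add0r mxE.
  by rewrite mxE !row_cons0 addr0.
by rewrite uM mxE !row_cons0 addr0.
Qed.

(** Linear forms of this shape cut out the top and bottom facets of towers. *)
Lemma sum_row_cons y (v : 'rV[R]_d.+1) :
  \sum_i row_cons y (fun=> 0) 0 i * v 0 i = y * v 0 ord0.
Proof.
rewrite big_ord_recl row_cons0 big1 ?addr0 // => i _.
by rewrite row_consS mul0r.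
Qed.

Lemma facet_tower_top a b l : a < b -> (forall i y, 0 < l i y) ->
  facet (tower b b l) (tower a b l).
Proof.
move=> lt_ab l_gt0; split; last first.
  by exists d; split; [exact/has_dim_setT/affine_span_tower|exact: has_dim_slice].
exists (row_cons 1 (fun=> 0)), b; split=> [v [/andP[_ vb] _]|].
  by rewrite sum_row_cons mul1r.
apply/seteqP; split=> v.
  move=> [vb vl]; split; last by rewrite /= sum_row_cons mul1r; have /le_anti := vb.
  by split=> //; have /andP[/(le_trans (ltW lt_ab)) -> ->] := vb.
by move=> [[_ vl]] /=; rewrite sum_row_cons mul1r => vb; split=> //; rewrite vb lexx.
Qed.

Lemma facet_tower_bottom a b l : a < b -> (forall i y, 0 < l i y) ->
  facet (tower a a l) (tower a b l).
Proof.
move=> lt_ab l_gt0; split; last first.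
  by exists d; split; [exact/has_dim_setT/affine_span_tower|exact: has_dim_slice].
exists (row_cons (-1) (fun=> 0)), (- a); split=> [v [/andP[av _] _]|].
  by rewrite sum_row_cons mulN1r lerN2.
apply/seteqP; split=> v.
  move=> [va vl]; split.
    by split=> //; have /andP[-> /le_trans->] := va; rewrite // ltW.
  by rewrite /= sum_row_cons mulN1r; have /le_anti <- := va.
move=> [[_ vl]] /=; rewrite sum_row_cons mulN1r => /oppr_inj va.
by split=> //; rewrite va lexx.
Qed.
End TowerPieces.

(** * Towers as rational polytopes, and lattice points of their dilates *)

Section RationalTowers.
Variables (R : realType) (d : nat).
Implicit Types (v w : 'rV[R]_d.+1) (a b h : R) (l : 'I_d -> R -> R).

(** The vertices are the corners of the two extreme slices. The weights of a point are products of
    those of its relative height and of its relative slice coordinates. Conversely, the inequalities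
    of the tower are affine for heights in [a, b] and pass to convex combinations. *)
Lemma frustum_rational (a b : rat) (al be : 'I_d -> rat) l :
  a < b -> (forall i y, 0 < l i y) ->
  (forall i y, ratr a <= y <= ratr b -> l i y = ratr (al i) + ratr (be i) * y) ->
  convex_rational_polytope (tower (ratr a) (ratr b) l).
Proof.
move=> lt_ab l_gt0 lE.
have lt_abR : ratr a < ratr b :> R by rewrite ltr_rat.
pose ht (e : bool) := if e then b else a.
pose vert (t : bool * {ffun 'I_d -> bool}) : 'rV[rat]_d.+1 :=
  row_cons (ht t.1) (fun i => (t.2 i)%:R * (al i + be i * ht t.1)).
have htR e : ratr a <= (ratr (ht e) : R) <= ratr b.
  by case: e; rewrite /= lexx ltW.
have vertE t : map_mx ratr (vert t) = row_cons (ratr (ht t.1))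
    (fun i => (t.2 i)%:R * l i (ratr (ht t.1))) :> 'rV[R]__.
  rewrite map_row_cons; congr row_cons; apply/funext => i /=.
  by rewrite lE // rmorphM /= rmorph_nat rmorphD rmorphM.
exists (codom vert); apply/seteqP.
split=> [v [/andP[av vb] vl]|_ [m [u [c [Au c_ge0 c1 ->]]]]].
  pose lam : R := (v 0 ord0 - ratr a) / (ratr b - ratr a).
  have lam_ge0 : 0 <= lam by rewrite divr_ge0 // subr_ge0 // ltW.
  have lam_le1 : lam <= 1 by rewrite ler_pdivrMr ?subr_gt0 // mul1r lerB.
  pose p (e : bool) := if e then lam else 1 - lam.
  pose x i := v 0 (lift ord0 i) / l i (v 0 ord0).
  have x01 i : 0 <= x i <= 1.
    have /andP[v0 vli] := vl i; have li := l_gt0 i (v 0 ord0).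
    by rewrite divr_ge0 ?(ltW li) //= ler_pdivrMr // mul1r.
  (* Independent choices: coordinate [i] takes its full width with weight [x i] and 0 with weight
     [1 - x i]; [q1] is the total mass, [qx] the mean of the [i]-th choice. *)
  pose q i (e : bool) := if e then x i else 1 - x i.
  have q1 : \sum_(f : {ffun 'I_d -> bool}) \prod_i q i (f i) = 1.
    rewrite -(bigA_distr_bigA q) big1 // => i _.
    by rewrite big_bool /= addrC subrK.
  have qx i : \sum_(f : {ffun 'I_d -> bool}) (\prod_j q j (f j)) * (f i)%:R = x i.
    transitivity (\prod_j \sum_(e : bool) q j e * (if j == i then e%:R else 1)).
      rewrite bigA_distr_bigA; apply: eq_bigr => f _; rewrite big_split; congr (_ * _).
      by rewrite -big_mkcond big_pred1_eq.
    rewrite (bigD1 i) //= big_bool /= eqxx mulr1 mulr0 addr0 big1 ?mulr1 // => j ne_ji.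
    by rewrite big_bool /= (negbTE ne_ji) !mulr1 addrC subrK.
  pose W (t : bool * {ffun 'I_d -> bool}) := p t.1 * \prod_i q i (t.2 i).
  have pairE (F : bool -> {ffun 'I_d -> bool} -> R) :
      \sum_t F t.1 t.2 = \sum_f F true f + \sum_f F false f.
    by rewrite -(pair_bigA _ F) big_bool.
  have v0E : v 0 ord0 = lam * ratr b + (1 - lam) * ratr a.
    by rewrite /lam; field; rewrite gt_eqF // subr_gt0.
  have -> : v = \sum_t W t *: map_mx ratr (vert t).
    transitivity (row_cons (v 0 ord0) (fun i => v 0 (lift ord0 i))).
      exact/esym/row_consP.
    apply: row_consP => [|i]; rewrite summxE.
      transitivity (\sum_(t : bool * {ffun 'I_d -> bool})
        (p t.1 * ratr (ht t.1)) * \prod_i q i (t.2 i)).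
        by apply: eq_bigr => t _; rewrite vertE mxE row_cons0 /W mulrAC.
      rewrite (pairE (fun e f => p e * ratr (ht e) * \prod_i q i (f i))).
      by rewrite -!mulr_sumr q1 /= !mulr1.
    transitivity (\sum_(t : bool * {ffun 'I_d -> bool})
        (p t.1 * l i (ratr (ht t.1))) * ((\prod_j q j (t.2 j)) * (t.2 i)%:R)).
      by apply: eq_bigr => t _; rewrite vertE mxE row_consS /W; ring.
    rewrite (pairE (fun e f => p e * l i (ratr (ht e)) *
        ((\prod_j q j (f j)) * (f i)%:R))).
    rewrite -!mulr_sumr qx -mulrDl.
    have -> : v 0 (lift ord0 i) = l i (v 0 ord0) * x i.
      by rewrite mulrC divfK // gt_eqF.
    congr (_ * _); rewrite !lE ?lexx ?(ltW lt_abR) ?av //=; rewrite v0E; ring.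
  apply: convex_hull_fin => [t|t|].
  - by exists (vert t) => //; rewrite /= codom_f.
  - rewrite mulr_ge0 //; first by case: t.1; rewrite //= subr_ge0.
    apply: prodr_ge0 => i _; have /andP[x0 x1] := x01 i.
    by rewrite /q; case: (t.2 i); rewrite // subr_ge0.
  - rewrite (pairE (fun e f => p e * \prod_i q i (f i))) -!mulr_sumr q1 /=.
    by rewrite !mulr1 addrC subrK.
have uT k : tower (ratr a) (ratr b) l (u k).
  have [_ /codomP[t ->] <-] := Au k; rewrite vertE.
  split=> [|i]; rewrite ?row_consS row_cons0 //.
  have := l_gt0 i (ratr (ht t.1)).
  by case: (t.2 i); rewrite ?mul1r ?mul0r lexx => /ltW->.
have between k : ratr a <= u k 0 ord0 <= ratr b by have [] := uT k.
have sumE j : (\sum_k c k *: u k) 0 j = \sum_k c k * u k 0 j.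
  by rewrite summxE; apply: eq_bigr => k _; rewrite mxE.
have cst (z : R) : z = \sum_k c k * z by rewrite -mulr_suml c1 mul1r.
have le_sum (f g : 'I_m -> R) : (forall k, f k <= g k) ->
    \sum_k c k * f k <= \sum_k c k * g k.
  by move=> le_fg; apply: ler_sum => k _; rewrite ler_wpM2l.
have s0 : ratr a <= (\sum_k c k *: u k) 0 ord0 <= ratr b.
  rewrite sumE [ratr a]cst [ratr b]cst.
  by apply/andP; split; apply: le_sum => k; have /andP[] := between k.
split=> // i; rewrite lE // !sumE {1}[0]cst; apply/andP; split.
  by apply: le_sum => k; have [_ /(_ i)/andP[]] := uT k.
rewrite [ratr (al i)]cst mulr_sumr -big_split /=; apply: ler_sum => k _.
rewrite [ratr (be i) * _]mulrCA -mulrDr -lE // ler_wpM2l //.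
by have [_ /(_ i)/andP[]] := uT k.
Qed.

Lemma towerI a b (c : R) l : a <= b -> b <= c ->
  tower a b l `&` tower b c l = tower b b l.
Proof.
move=> le_ab le_bc; apply/seteqP; split=> v.
  by move=> [[/andP[_ vb] vl] [/andP[bv _] _]]; split=> //; rewrite bv vb.
move=> [/andP[bv vb] vl].
by split; split=> //; rewrite ?bv ?vb ?(le_trans le_ab bv) ?(le_trans vb le_bc).
Qed.

(** Cutting at the heights [Y j] gives frusta. Distinct ones that are not consecutive are disjoint;
    consecutive ones share a whole slice, since one function [l] gives the widths on both sides, and
    that slice is a facet of each. *)
Lemma tower_rational_polytope m (Y : nat -> rat) (al be : nat -> 'I_d -> rat) l :
  (0 < m)%N -> Y 0%N = 0 -> (forall j, (j < m)%N -> Y j < Y j.+1) ->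
  (forall i, continuous (l i)) -> (forall i y, 0 < l i y) ->
  (forall j i y, (j < m)%N -> ratr (Y j) <= y <= ratr (Y j.+1) ->
     l i y = ratr (al j i) + ratr (be j i) * y) ->
  rational_polytope d.+1 (tower 0 (ratr (Y m)) l).
Proof.
move=> m_gt0 Y0 Ylt cl l_gt0 lE.
have Yle i j : (i <= j <= m)%N -> Y i <= Y j.
  elim: j => [|j IH]; rewrite leq_eqVlt => /andP[/orP[/eqP->//|lt_ij] le_jm] //.
  by apply: le_trans (IH _) (ltW (Ylt _ le_jm)); rewrite -ltnS lt_ij ltnW.
have h_gt0 : 0 < ratr (Y m) :> R.
  rewrite ltr0q -Y0; apply: lt_le_trans (Ylt _ m_gt0) (Yle _ _ _).
  by rewrite m_gt0 leqnn.
have YltR j : (j < m)%N -> ratr (Y j) < ratr (Y j.+1) :> R.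
  by move=> /Ylt; rewrite ltr_rat.
pose P (j : 'I_m) := tower (ratr (Y j)) (ratr (Y j.+1)) l.
have adj (i j : 'I_m) : (i < j)%N -> P i `&` P j !=set0 -> i.+1 = j.
  move=> lt_ij [v [[/andP[_ vi] _] [/andP[jv _] _]]]; apply/eqP.
  rewrite eqn_leq lt_ij /= leqNgt; apply/negP => lt_i1j.
  have := le_trans jv vi; rewrite ler_rat leNgt => /negP; apply.
  apply: lt_le_trans (Ylt i.+1 _) (Yle _ _ _); first exact: ltn_trans lt_i1j _.
  by rewrite lt_i1j ltnW.
have facets (i j : 'I_m) : (i < j)%N -> P i `&` P j !=set0 ->
    facet (P i `&` P j) (P i) /\ facet (P i `&` P j) (P j).
  move=> lt_ij /adj - /(_ lt_ij) ij.
  have -> : P i `&` P j = tower (ratr (Y j)) (ratr (Y j)) l.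
    by rewrite /P -ij towerI // ltW // YltR // ij.
  by split; [rewrite /P ij; apply: facet_tower_top|apply: facet_tower_bottom];
    rewrite // -?ij YltR // ij.
split.
- exact: tower_topological_ball.
- exact/has_dim_setT/affine_span_tower.
- exists m, P; split.
  + apply/seteqP; split=> v.
      move=> [/andP[v0 vh] vl].
      suff [j jm vj] : exists2 j, (j < m)%N & ratr (Y j) <= v 0 ord0 <= ratr (Y j.+1).
        by exists (Ordinal jm).
      elim: m m_gt0 vh {P Ylt lE Yle h_gt0 YltR adj facets} => // -[|m] IH _ vh.
        by exists 0%N => //; rewrite Y0 rmorph0 v0.
      have [/IH[]// j jm vj|/ltW le_v] := leP (v 0 ord0) (ratr (Y m.+1)).
        by exists j => //; apply: ltnW.
      by exists m.+1 => //; rewrite le_v.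
    move=> [j _ [/andP[jv vj] vl]]; split=> //; apply/andP; split.
      apply: le_trans jv; rewrite ler0q -Y0 Yle //=; exact: ltnW.
    by apply: le_trans vj _; rewrite ler_rat Yle // ltn_ord leqnn.
  + move=> j; apply: (@frustum_rational _ _ (al j) (be j)) => [||i y] //.
      exact: Ylt.
    exact: lE.
  + by move=> i j; rewrite !affine_span_tower // YltR.
  + move=> i j; rewrite neq_ltn => /orP[|]; first exact: facets.
    by move=> lt_ji; rewrite setIC => /facets-/(_ lt_ji)[].
Qed.

(** A lattice point is a row [Y] with an independent choice of each other coordinate in 0, ...,
    [cnt i Y], hence a sum of products. The hypotheses describe the floors of the dilated height and
    widths through comparisons only. *)
Lemma card_tower_points h l (k M : nat) (cnt : 'I_d -> nat -> nat) :
  (0 < k)%N ->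
  (forall Y : nat, (Y%:R <= k%:R * h) = (Y <= M)%N) ->
  (forall i (Y x : nat), (Y <= M)%N ->
     (x%:R <= k%:R * l i (Y%:R / k%:R)) = (x <= cnt i Y)%N) ->
  (dilate k (tower 0 h l) `&` @integer_points R d.+1
     #= `I_(\sum_(Y < M.+1) \prod_i (cnt i Y).+1))%card.
Proof.
move=> k_gt0 hM lcnt; have kR : 0 < k%:R :> R by rewrite ltr0n.
pose F (Y : 'I_M.+1) := {dffun forall i : 'I_d, 'I_(cnt i Y).+1}.
pose phi (t : {Y : 'I_M.+1 & F Y}) : 'rV[R]_d.+1 :=
  row_cons (tag t)%:R (fun i => (tagged t i)%:R).
have phi_inj : injective phi.
  move=> [Y f] [Y' f'] eq_phi.
  have := congr1 (fun v : 'rV[R]_d.+1 => v 0 ord0) eq_phi.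
  rewrite !row_cons0 => /eqP; rewrite eqr_nat => /eqP/val_inj /= eqY.
  case: _ / eqY f' eq_phi => f' eq_phi; congr Tagged; apply/ffunP => i; apply/val_inj.
  have := congr1 (fun v : 'rV[R]_d.+1 => v 0 (lift ord0 i)) eq_phi.
  by rewrite !row_consS => /eqP; rewrite eqr_nat => /eqP.
have -> : dilate k (tower 0 h l) `&` @integer_points R d.+1 = phi @` setT.
  apply/seteqP; split=> v.
    move=> [[x [/andP[x0 xh] xl] kxv] [z _ zv]].
    have xz j : k%:R * x 0 j = (z 0 j)%:~R.
      have := congr1 (fun u : 'rV[R]_d.+1 => u 0 j) (etrans kxv (esym zv)).
      by rewrite !mxE.
    have x_ge0 j : 0 <= x 0 j.
      by case: (unliftP ord0 j) => [i|] -> //; have /andP[] := xl i.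
    pose Z j := absz (z 0 j).
    have zE j : (z 0 j)%:~R = (Z j)%:R :> R.
      by rewrite natr_absz ger0_norm // -(ler0z R) -xz mulr_ge0 // ltW.
    have YM : (Z ord0 < M.+1)%N.
      by rewrite ltnS -hM -zE -xz ler_wpM2l // ltW.
    have x0E : x 0 ord0 = (Z ord0)%:R / k%:R.
      by rewrite -zE -xz mulrC mulKf // gt_eqF.
    have fP i : (Z (lift ord0 i) < (cnt i (Ordinal YM)).+1)%N.
      rewrite ltnS -lcnt //= -zE -xz -x0E ler_wpM2l ?(ltW kR) //.
      by have /andP[] := xl i.
    exists (Tagged F (finfun (fun i => Ordinal (fP i)) : F (Ordinal YM))) => //.
    apply: row_consP => [|i]; rewrite -zv mxE zE //=.
    by rewrite ffunE.
  move=> [[Y f] _ <-]; split.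
    exists (k%:R^-1 *: phi (Tagged F f)); last first.
      by rewrite scalerA mulfV ?scale1r // gt_eqF.
    have YM : (Y <= M)%N by rewrite -ltnS.
    split=> [|i]; rewrite !mxE ?unlift_none ?liftK /=.
      rewrite mulr_ge0 ?invr_ge0 ?ler0n //= mulrC ler_pdivrMr // mulrC hM //.
    rewrite mulr_ge0 ?invr_ge0 ?ler0n //= mulrC ler_pdivrMr // mulrC.
    by rewrite [_^-1 * _]mulrC lcnt // -ltnS.
  exists (row_cons (Y : int) (fun i => (f i : nat) : int)) => //.
  by rewrite map_row_cons.
apply: (card_eq_trans (inj_card_eq (in2W phi_inj))).
have -> : (\sum_(Y < M.+1) \prod_i (cnt i Y).+1 = #|{: {Y : 'I_M.+1 & F Y}}|)%N.
  rewrite card_tagged sumnE big_map big_enum; apply: eq_bigr => Y _.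
  rewrite card_dep_ffun foldrE big_map big_enum; apply: eq_bigr => i _.
  by rewrite card_ord.
have -> : `I_#|{: {Y : 'I_M.+1 & F Y}}| =
    (fun t : {Y : 'I_M.+1 & F Y} => enum_rank t : nat) @` setT.
  apply/seteqP; split=> [x /= lt_x|_ [t _ <-]]; last exact: ltn_ord.
  by exists (enum_val (Ordinal lt_x)); rewrite // enum_valK.
rewrite card_eq_sym; apply: inj_card_eq; apply: in2W => t t' /val_inj.
exact: enum_rank_inj.
Qed.

End RationalTowers.

(** * Ehrhart coefficients *)

Section EhrhartCriterion.
Variables (R : realType) (n : nat).

(** The term [- A * (k %% p)%:R] becomes the varying part of coefficient [j]; everything else comes
    from the constant coefficients of a polynomial. *)
Lemma has_period_sequence_single (B : set 'rV[R]_n) (p j : nat) (A : rat)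
    (G : nat -> rat) :
  (0 < p)%N -> (j <= n)%N -> A != 0 -> polynomial_fun n G ->
  (forall k, (0 < k)%N -> exists N : nat,
     (dilate k B `&` @integer_points R n #= `I_N)%card /\
     N%:R = G k - A * (k %% p)%:R * k%:R ^+ j) ->
  has_period_sequence B (fun i : 'I_n.+1 => if (i == j :> nat)%N then p else 1%N).
Proof.
move=> p_gt0 le_jn A_neq0 [Q sQ GQ] count.
pose c (i : 'I_n.+1) (z : int) : rat :=
  Q`_i - (if i == j :> nat then A * ((z %% p)%Z)%:~R else 0).
have perj (i : 'I_n.+1) : i = j :> nat -> is_period (c i) p.
  by move=> ij; split=> // z; rewrite /c modzDr.
have per1 (i : 'I_n.+1) : i != j :> nat -> is_period (c i) 1.
  by move=> /negbTE ij; split=> // z; rewrite /c ij.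
exists c; split.
  split=> [i|k k_gt0].
    by have [/perj|/per1] := eqVneq (i : nat) j; eexists; eauto.
  have [N [cN NE]] := count k k_gt0; exists N; split=> //; rewrite NE.
  under eq_bigr do rewrite /c mulrBl.
  rewrite sumrB GQ (horner_coef_wide _ sQ); congr (_ - _).
  rewrite (bigD1 (Ordinal (le_jn : (j < n.+1)%N))) //= eqxx big1 ?addr0 => [|i].
    by rewrite modz_nat.
  by rewrite -val_eqE /= => /negbTE->; rewrite mul0r.
move=> i; have [ij|ij] := eqVneq (i : nat) j; last first.
  by split=> [|q' []//]; exact: per1.
split=> [|q' [q'_gt0 per]]; first exact: perj.
(* Comparing the values at 0 and at the period [q'] gives A (q' mod p) = 0, so [p] divides [q']. *)
have := per 0; rewrite /c ij eqxx add0r mod0z modz_nat mulr0 subr0 => /eqP.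
rewrite -subr_eq0 addrAC subrr add0r oppr_eq0 mulf_eq0 (negbTE A_neq0) /=.
by rewrite intr_eq0 => /dvdn_leq; apply.
Qed.

End EhrhartCriterion.

(** With p = q + 1, the top row of the dilate is floor(k (p + 1 + 1/p)) = p k + k + floor(k/p); p k
    is written [q * k + k] to match the two notches. *)
Lemma le_height (R : realType) (q k Y : nat) :
  (Y%:R <= k%:R * (q.+1%:R + 1 + q.+1%:R^-1) :> R) =
  (Y <= q * k + k + k + k %/ q.+1)%N.
Proof.
set pR : R := q.+1%:R; have p_gt0 : 0 < pR by rewrite ltr0n.
rewrite -(ler_pM2r p_gt0).
have -> : k%:R * (pR + 1 + pR^-1) * pR = (k * (q.+2 * q.+1 + 1))%:R.
  by rewrite natrM natrD natrM -[q.+2%:R]natr1 -/pR; clearbody pR;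
    field; rewrite gt_eqF.
rewrite -natrM ler_nat -leq_divRL //; congr (_ <= _)%N.
by rewrite mulnDr muln1 mulnA divnMDl //; lia.
Qed.

(** * The notched tower: widths, row lengths and polytope structure *)

Section NotchedTower.
Variables (R : realType) (q : nat).
Hypothesis q_gt0 : (0 < q)%N.

Let qR : R := q%:R.
Let pR : R := q.+1%:R.

Lemma notch_pE : pR = qR + 1. Proof. by rewrite /pR -natr1. Qed.

Lemma notch_q_ge1 : 1 <= qR. Proof. by rewrite ler1n. Qed.

(* With p = q + 1, this is the piecewise linear function with vertices (0, 1),
   (q/p, 1/p), (q, 1), (q + 1/p, 1/p) and (p, 1), constant from (p, 1) on: the
   right-hand boundary of the polygon W. *)
Definition notch (y : R) : R :=
  Num.max (1 - y) (Num.min (y / qR)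
    (Num.max (1 - qR * (y - qR)) (Num.min (y - qR) 1))).

Definition ramp (y : R) : R := Num.max 0 (Num.min 1 (y - pR)).

Lemma notch_low y : 0 <= y <= qR -> notch y = Num.max (1 - y) (y / qR).
Proof.
have q1 := notch_q_ge1; move=> /andP[y0 yq]; rewrite /notch min_l // le_max.
apply/orP; left; apply: (@le_trans _ _ 1); last by nra.
by rewrite ler_pdivrMr; lra.
Qed.

Lemma notch_high y :
  qR <= y <= pR -> notch y = Num.max (1 - qR * (y - qR)) (y - qR).
Proof.
have q1 := notch_q_ge1; rewrite notch_pE => /andP[qy yp].
rewrite /notch [Num.min (y - qR) 1]min_l ?[Num.min (y / qR) _]min_r; last lra.
  by rewrite max_r // le_max; apply/orP; right; lra.
apply: (@le_trans _ _ 1); last by rewrite ler_pdivlMr; lra.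
by rewrite ge_max; apply/andP; split; nra.
Qed.

Lemma notch_top y : pR <= y -> notch y = 1.
Proof.
have q1 := notch_q_ge1; rewrite notch_pE => py.
rewrite /notch [Num.min (y - qR) 1]min_r; last lra.
rewrite [Num.max (1 - qR * _) 1]max_r; last nra.
rewrite min_r; last by rewrite ler_pdivlMr; lra.
by rewrite max_r; lra.
Qed.

Lemma ramp_low y : y <= pR -> ramp y = 0.
Proof. by move=> yp; rewrite /ramp max_l // ge_min; apply/orP; right; lra. Qed.

Lemma ramp_mid y : pR <= y <= pR + 1 -> ramp y = y - pR.
Proof.
by move=> /andP[py yp]; rewrite /ramp min_r ?max_r; lra.
Qed.

Lemma ramp_top y : pR + 1 <= y -> ramp y = 1.
Proof. by move=> py; rewrite /ramp min_l ?max_r; lra. Qed.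

Lemma notch_continuous : continuous notch.
Proof.
have cB c : continuous (fun y : R => y - c).
  by move=> y; apply: cvgB; [exact: cvg_id|exact: cvg_cst].
have cBr c a : continuous (fun y : R => c - a * (y - qR)).
  move=> y; apply: cvgB; first exact: cvg_cst.
  by apply: cvgM; [exact: cvg_cst|exact: cB].
apply: max_fun_continuous.
  by move=> y; apply: cvgB; [exact: cvg_cst|exact: cvg_id].
apply: min_fun_continuous.
  by move=> y; apply: cvgM; [exact: cvg_id|exact: cvg_cst].
apply: max_fun_continuous; first exact: cBr.
by apply: min_fun_continuous; [exact: cB|exact: cst_continuous].
Qed.

Lemma notch_gt0 y : 0 < notch y.
Proof.
have q1 := notch_q_ge1; rewrite /notch lt_max; have [y1|y1] := ltP y 1.
  by apply/orP; left; lra.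
apply/orP; right; rewrite lt_min divr_gt0 ?lt_max /=; [|lra|lra].
have [yq|yq] := leP y qR; apply/orP; [left; nra|right].
by rewrite lt_min; lra.
Qed.

Variables (e : nat) (w s : 'I_e.+1 -> nat).

(* The last index of row [Y] of the [k]-th dilate in direction [i]: the four cases
   are the two notches, the frustum and the prism. *)
Definition row_length (k : nat) (i : 'I_e.+1) (Y : nat) : nat :=
  if (Y < q * k)%N then
    if i == ord_max then maxn (k - Y) (Y %/ q) else (w i * k)%N
  else if (Y < q * k + k)%N then
    if i == ord_max then maxn (k - q * (Y - q * k)) (Y - q * k) else (w i * k)%N
  else if (Y < q * k + k + k)%N then
    ((k - (Y - (q * k + k))) * w i + (Y - (q * k + k)) * s i)%N
  else (s i * k)%N.

(* The term in [k %/ q.+1] stands on the left so as to avoid a truncated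
   subtraction. *)
Lemma sum_row_lengths k :
  (\sum_(Y < (q * k + k + k + k %/ q.+1).+1) \prod_i (row_length k i Y).+1 +
   k %/ q.+1 * \prod_(i | i != ord_max) (w i * k).+1 =
   (q.+2 * 'C(k, 2) + q.+3 * k) * \prod_(i | i != ord_max) (w i * k).+1 +
   \sum_(j < k) \prod_i ((k - j) * w i + j * s i).+1 +
   (k %/ q.+1).+1 * \prod_i (s i * k).+1)%N.
Proof.
set L := (\prod_(i | i != ord_max) _)%N.
(* In the rows of the notches only the last direction has varying length, so the common factor [L]
   comes out. *)
have lastE (F : 'I_e.+1 -> nat) a : (forall i, i != ord_max -> F i = w i * k)%N ->
    F ord_max = a -> (\prod_i (F i).+1 = a.+1 * L)%N.
  move=> Fw Fa; rewrite (bigD1 ord_max) //= Fa; congr (_ * _)%N.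
  by apply: eq_bigr => i /Fw->.
(* The additional top row goes to the prism: each lower layer leaves its upper end to the next
   one. *)
rewrite -addnS !big_split_ord /=.
under eq_bigr => Y _.
  rewrite (lastE _ (maxn (k - Y) (Y %/ q))); last first.
  - by rewrite /row_length ltn_ord eqxx.
  - by move=> i /negbTE im; rewrite /row_length ltn_ord im.
  over.
under [X in (_ + X + _ + _ + _)%N]eq_bigr => u _.
  rewrite (lastE _ (maxn (k - q * u) u)); last first.
  - by rewrite /row_length ltnNge leq_addr /= ltn_add2l ltn_ord eqxx addKn.
  - move=> i /negbTE im.
    by rewrite /row_length ltnNge leq_addr /= ltn_add2l ltn_ord im.
  over.
under [X in (_ + X + _ + _)%N]eq_bigr => j _.
  under eq_bigr => i _.
    rewrite /row_length ltnNge -addnA leq_addr /= ltnNge addnA leq_addr /=.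
    rewrite ltn_add2l ltn_ord addKn.
    over.
  over.
under [X in (_ + X + _)%N]eq_bigr => j _.
  under eq_bigr => i _.
    rewrite /row_length ltnNge -!addnA leq_addr /= ltnNge !addnA -addnA leq_addr /=.
    rewrite ltnNge addnA leq_addr /=.
    over.
  over.
rewrite -!big_distrl /= sum_nat_const card_ord.
have Sc m (f : nat -> nat) : (\sum_(i < m) (f i).+1 = \sum_(i < m) f i + m)%N.
  by under eq_bigr do rewrite -addn1; rewrite big_split sum1_card card_ord.
rewrite (Sc _ (fun y => maxn (k - y) (y %/ q))) (Sc _ (fun u => maxn (k - q * u) u)).
have := sum_notched_rows k q_gt0.
set a := (\sum_(y < q * k) _)%N; set b := (\sum_(u < k) maxn _ _)%N => ab.
set c := (\sum_(j < k) _)%N; set S := (\prod_i (s i * k).+1)%N.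
(* The successor in each of the [q * k + k] notched rows turns [2 * k] into [q.+3 * k]. *)
have : ((a + b + k %/ q.+1 + q * k + k) * L = (q.+2 * 'C(k, 2) + q.+3 * k) * L)%N.
  by rewrite ab; congr (_ * _)%N; lia.
rewrite !mulnDl; lia.
Qed.

Hypotheses (w_gt0 : forall i, (0 < w i)%N) (s_gt0 : forall i, (0 < s i)%N).
Hypothesis w_last : w ord_max = 1%N.

(* The widths of the slices of B; [w] holds the sides of T' and, as last entry,
   the width 1 of W at its top. *)
Definition width (i : 'I_e.+1) (y : R) : R :=
  (if i == ord_max then notch y else (w i)%:R) + ((s i)%:R - (w i)%:R) * ramp y.

Lemma width_continuous i : continuous (width i).
Proof.
have cr : continuous ramp.
  apply: max_fun_continuous; first exact: cst_continuous.
  apply: min_fun_continuous; first exact: cst_continuous.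
  by move=> y; apply: cvgB; [exact: cvg_id|exact: cvg_cst].
move=> y; apply: cvgD; last by apply: cvgM; [exact: cvg_cst|exact: cr].
by case: ifP => _; [exact: notch_continuous|exact: cvg_cst].
Qed.

Lemma width_gt0 i y : 0 < width i y.
Proof.
have w1 : 0 < (w i)%:R :> R by rewrite ltr0n.
have s1 : 0 < (s i)%:R :> R by rewrite ltr0n.
rewrite /width; have [yp|/ltW py] := leP y pR.
  rewrite ramp_low // mulr0 addr0; case: ifP => _ //; exact: notch_gt0.
(* From height p on, the width is a convex combination of [w i] and [s i]. *)
have -> : (if i == ord_max then notch y else (w i)%:R) = (w i)%:R.
  by case: eqP => // ->; rewrite notch_top // w_last.
have : 0 <= ramp y <= 1.
  by rewrite /ramp le_max lexx ge_max ler01 ge_min lexx.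
by nra.
Qed.

Lemma width_low i y :
  y <= pR -> width i y = if i == ord_max then notch y else (w i)%:R.
Proof. by move=> yp; rewrite /width ramp_low // mulr0 addr0. Qed.

Lemma width_high i y :
  pR <= y -> width i y = (w i)%:R + ((s i)%:R - (w i)%:R) * ramp y.
Proof.
by move=> py; rewrite /width; case: eqP => // ->; rewrite notch_top // w_last.
Qed.

Let heights : seq rat :=
  [:: 0; q%:R / q.+1%:R; q%:R; q%:R + q.+1%:R^-1; q.+1%:R; q.+1%:R + 1;
      q.+1%:R + 1 + q.+1%:R^-1].

(** On layer [j] the width [i] is [base_coef j i + slope_coef j i * y]: layers 0 to 3 are the four
    edges of the notches, 4 is the frustum, 5 the prism. *)
Let base_coef (j : nat) (i : 'I_e.+1) : rat :=
  match j with
  | 4 => (w i)%:R - ((s i)%:R - (w i)%:R) * q.+1%:R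
  | 5 => (s i)%:R
  | _ => if i == ord_max then [:: 1; 0; 1 + q%:R ^+ 2; - q%:R]`_j else (w i)%:R
  end.

Let slope_coef (j : nat) (i : 'I_e.+1) : rat :=
  match j with
  | 4 => (s i)%:R - (w i)%:R
  | 5 => 0
  | _ => if i == ord_max then [:: -1; q%:R^-1; - q%:R; 1]`_j else 0
  end.

Lemma notched_tower_polytope :
  rational_polytope e.+2 (tower 0 (pR + 1 + pR^-1) width).
Proof.
have q1 := notch_q_ge1; have pE := notch_pE.
have p_gt0 : 0 < pR by lra.
have pV : 0 < pR^-1 <= 1 by rewrite invr_gt0 p_gt0 invf_le1 //; lra.
have ppV : pR * pR^-1 = 1 by rewrite mulfV; lra.
have qqV : qR * qR^-1 = 1 by rewrite mulfV; lra.
have qV_gt0 : 0 < qR^-1 by rewrite invr_gt0; lra.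
have hE : ratr heights`_6 = pR + 1 + pR^-1.
  by rewrite /= !(rmorphD, fmorphV, rmorph_nat, rmorph1).
rewrite -hE; apply: (@tower_rational_polytope _ _ 6 (nth 0 heights)
  base_coef slope_coef) => //.
- have q1' : 1 <= q%:R :> rat by rewrite ler1n.
  have pE' : q.+1%:R = q%:R + 1 :> rat by rewrite -natr1.
  have pV' : 0 < q.+1%:R^-1 :> rat by rewrite invr_gt0 ltr0n.
  have pV1 : q.+1%:R^-1 < 1 :> rat by rewrite invf_lt1 ?ltr0n ?ltr1n.
  have qp : q%:R / q.+1%:R = 1 - q.+1%:R^-1 :> rat.
    by rewrite pE'; field; rewrite -pE' pnatr_eq0.
  do 6?[case=> [_|]] => //=; rewrite ?qp;
    move: (q.+1%:R^-1) pV' pV1 => u u_gt0 u_lt1; lra.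
- exact: width_continuous.
- exact: width_gt0.
- have ratrE := (rmorphN, rmorphD, rmorphB, rmorphM, rmorphXn, fmorphV, rmorph_nat,
    rmorph0, rmorph1).
  have yqp y : (y <= qR / pR) = (y * pR <= qR) by rewrite ler_pdivlMr.
  have qpy y : (qR / pR <= y) = (qR <= y * pR) by rewrite ler_pdivrMr.
  have ypV y : (y <= qR + pR^-1) = ((y - qR) * pR <= 1).
    by rewrite -lerBlDl -[pR^-1]mul1r ler_pdivlMr.
  have pVy y : (qR + pR^-1 <= y) = (1 <= (y - qR) * pR).
    by rewrite -lerBrDl -[pR^-1]mul1r ler_pdivrMr.
  move=> j i y; do 6?[case: j => [_|j]] => //=; rewrite !ratrE /= -/qR -/pR => /andP[].
  + rewrite yqp => ya yb; have yp : y <= pR by nra.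
    rewrite width_low //; case: eqP => _; rewrite !ratrE ?mul0r ?addr0 //.
    rewrite notch_low ?max_l; first by rewrite mulN1r.
      by rewrite ler_pdivrMr; nra.
    by nra.
  + rewrite qpy => ya yb; have yp : y <= pR by lra.
    rewrite width_low //; case: eqP => _; rewrite !ratrE ?mul0r ?addr0 //.
    rewrite notch_low ?max_r; first by rewrite add0r mulrC.
      by rewrite ler_pdivlMr; nra.
    by nra.
  + rewrite ypV => ya yb; have yp : y <= pR by nra.
    rewrite width_low //; case: eqP => _; rewrite !ratrE ?mul0r ?addr0 //.
    rewrite notch_high ?ya // max_l; first by rewrite -/qR; ring.
    by nra.
  + rewrite pVy => ya yb.
    rewrite width_low //; case: eqP => _; rewrite !ratrE ?mul0r ?addr0 //.
    rewrite notch_high ?max_r; [by rewrite -/qR; ring|by nra|by nra].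
  + move=> ya yb; rewrite width_high // ramp_mid ?ya // -/pR; ring.
  + move=> ya _; have yp : pR <= y by lra.
    by rewrite width_high // ramp_top //; ring.
Qed.

(** At height [Y / k] every linear piece of the dilated widths is an integer, except [Y / q] in the
    lower notch, which is rounded down to [Y %/ q]. *)
Lemma le_row_length (k : nat) i (Y x : nat) : (0 < k)%N ->
  (x%:R <= k%:R * width i (Y%:R / k%:R)) = (x <= row_length k i Y)%N.
Proof.
move=> k_gt0; have kR : 0 < k%:R :> R by rewrite ltr0n.
have q1 := notch_q_ge1; have pE := notch_pE.
rewrite mulrC -ler_pdivrMr // /row_length; set y := Y%:R / k%:R.
have yE : Y%:R = y * k%:R by rewrite divfK // gt_eqF.
have cst (c : nat) : (x%:R / k%:R <= c%:R :> R) = (x <= c * k)%N.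
  by rewrite ler_pdivrMr // -natrM ler_nat.
have y_ge0 : 0 <= y by rewrite divr_ge0 // ler0n.
case: ltnP => [ltY|geY].
  have yq : y <= qR by rewrite ler_pdivrMr // -natrM ler_nat ltnW.
  rewrite width_low; last lra.
  case: eqP => _ //; rewrite notch_low ?y_ge0 // le_max.
  have -> : (x%:R / k%:R <= 1 - y) = (x + Y <= k)%N.
    by rewrite ler_pdivrMr // mulrBl mul1r -yE lerBrDr -natrD ler_nat.
  have -> : (x%:R / k%:R <= y / qR) = (x <= Y %/ q)%N.
    rewrite ler_pdivrMr // mulrAC -yE ler_pdivlMr ?ltr0n //.
    by rewrite -natrM ler_nat leq_divRL.
  (* For [Y > k] the truncated [k - Y] is 0 and leaves the maximum unchanged. *)
  by rewrite leq_max; move: (Y %/ q)%N => z; lia.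
have qy : qR <= y by rewrite ler_pdivlMr // -natrM ler_nat.
case: ltnP => [ltY|geY'].
  have yp : y <= pR.
    by rewrite ler_pdivrMr // -natrM ler_nat mulSn addnC ltnW.
  rewrite width_low //; case: eqP => _ //; rewrite notch_high ?qy // le_max.
  have uE : (Y - q * k)%:R = (y - qR) * k%:R by rewrite natrB // natrM yE mulrBl.
  have -> : (x%:R / k%:R <= 1 - qR * (y - qR)) = (x + q * (Y - q * k) <= k)%N.
    by rewrite ler_pdivrMr // mulrBl mul1r -mulrA -uE lerBrDr -natrM -natrD ler_nat.
  have -> : (x%:R / k%:R <= y - qR) = (x <= Y - q * k)%N.
    by rewrite ler_pdivrMr // -uE ler_nat.
  by rewrite leq_max; move: (q * (Y - q * k))%N => z; lia.
have py : pR <= y.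
  by rewrite ler_pdivlMr // -natrM ler_nat mulSn addnC.
rewrite width_high //; case: ltnP => [ltY|geY''].
  have yp : y <= pR + 1.
    rewrite ler_pdivrMr // mulrDl mul1r -natrM -natrD ler_nat; lia.
  rewrite ramp_mid ?py // ler_pdivrMr //.
  have jE : (Y - (q * k + k))%:R = (y - pR) * k%:R.
    by rewrite natrB // natrD natrM yE pE; ring.
  rewrite -[in RHS](ler_nat R) natrD !natrM natrB; last lia.
  by rewrite jE; congr (_ <= _); ring.
have yp : pR + 1 <= y.
  rewrite ler_pdivlMr // mulrDl mul1r -natrM -natrD ler_nat; lia.
by rewrite ramp_top // mulr1 addrC subrK cst.
Qed.

End NotchedTower.

(** * Period sequences of the cube and of the notched tower *)

Lemma cube_period_sequence (R : realType) (d : nat) :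
  exists B : set 'rV[R]_d.+1, rational_polytope d.+1 B /\
    has_period_sequence B (fun=> 1%N).
Proof.
pose l (_ : 'I_d) (_ : R) : R := 1.
exists (tower 0 1 l); split.
  have h1 : 1 = ratr 1%:R :> R by rewrite rmorph1.
  rewrite [X in tower _ X]h1.
  apply: (@tower_rational_polytope R d 1 (fun j => j%:R) (fun _ _ => 1) (fun _ _ => 0)).
  - by [].
  - by [].
  - by move=> j _; rewrite ltr_nat.
  - by move=> i; exact: cst_continuous.
  - by move=> i y; exact: ltr01.
  - by move=> j i y _ _; rewrite rmorph1 rmorph0 mul0r addr0.
have pG : polynomial_fun d.+1 (fun k => k.+1%:R ^+ d.+1).
  have pS : polynomial_fun 1 (fun k => k.+1%:R).
    apply: polynomial_fun_ext
      (polynomial_funD polynomial_fun_id (polynomial_fun_cst 1 1)).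
    by move=> k; rewrite natr1.
  have := @polynomial_fun_prod 'I_d.+1 (fun _ k => k.+1%:R) (fun=> pS).
  by rewrite card_ord; apply: polynomial_fun_ext => k; rewrite prodr_const card_ord.
(* The constant sequence is put in the form of the criterion with exponent 0 and period 1; as
   [k %% 1] is 0, no correction term remains. *)
have -> : (fun=> 1%N) = (fun i : 'I_d.+2 => if (i == 0 :> nat)%N then 1%N else 1%N).
  by apply/funext => i; case: eqP.
apply: (@has_period_sequence_single _ _ _ 1 0 1 _ _ _ _ pG) => //.
move=> k k_gt0; exists (\sum_(Y < k.+1) \prod_(i < d) k.+1)%N; split.
  apply: (@card_tower_points R d 1 l k k (fun _ _ => k)) => // [Y|i Y x _].
    by rewrite mulr1 ler_nat.
  by rewrite mulr1 ler_nat.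
rewrite modn1 mulr0 mul0r subr0 -natrX; congr _%:R.
by rewrite prod_nat_const !card_ord sum_nat_const card_ord expnS.
Qed.

Lemma notched_tower_period_sequence (R : realType) (q e : nat)
    (s t : 'I_e.+1 -> nat) :
  (0 < q)%N -> (forall i, (0 < s i)%N) ->
  (forall i, i != ord_max -> (0 < t i)%N) -> t ord_max = 0%N ->
  (forall j, (1 <= j <= e)%N -> (\sum_i s i ^ j = \sum_i t i ^ j)%N) ->
  exists B : set 'rV[R]_e.+2, rational_polytope e.+2 B /\
    has_period_sequence B
      (fun i : 'I_e.+3 => if (i == e.+1 :> nat)%N then q.+1 else 1%N).
Proof.
move=> q_gt0 s_gt0 t_gt0 t_last st.
(* The zero side of T is replaced by 1, the width of the notched polygon W at its top. *)
pose w i := if i == ord_max then 1%N else t i.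
have w_gt0 i : (0 < w i)%N by rewrite /w; case: ifPn => // /t_gt0.
have w_last : w ord_max = 1%N by rewrite /w eqxx.
exists (tower 0 (q.+1%:R + 1 + q.+1%:R^-1) (@width R q e w s)); split.
  exact: notched_tower_polytope.
have [A A_neq0 AE] : exists2 A : rat, A != 0 & forall x : rat,
    \prod_i ((s i)%:R * x + 1) - \prod_i ((t i)%:R * x + 1) = A * x ^+ e.+1.
  apply: prod_linear_sub_monomial; first by move=> i; rewrite ltr0n.
    by rewrite t_last.
  move=> j /st/(congr1 (fun a => a%:R : rat)); rewrite !natr_sum.
  by under eq_bigr do rewrite natrX; move=> ->; apply: eq_bigr => i _; rewrite natrX.
(* For the [k]-th dilates, [LS] and [LT] count the points of S and T', [C] those of the frustum
   without its top slice, and [V k * LT k] those of T' x W without its top slice, up to floor(k/p)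
   [LT k]. *)
pose LS (k : nat) : rat := \prod_i ((s i)%:R * k%:R + 1).
pose LT (k : nat) : rat := \prod_(i < e) ((t (widen_ord (leqnSn e) i))%:R * k%:R + 1).
pose C (k : nat) : rat := \sum_(j < k)
  \prod_i ((w i)%:R * k%:R + ((s i)%:R - (w i)%:R) * j%:R + 1).
pose V (k : nat) : rat := q.+2%:R * (\sum_(j < k) j%:R ^+ 1) + q.+3%:R * k%:R.
(* The last term comes from floor(k/p) = (k - k mod p)/p: it is the polynomial part of A k^(e+1)
   floor(k/p). *)
pose G k := V k * LT k + C k + LS k + A / q.+1%:R * k%:R ^+ e.+2.
have linear (c : nat) : polynomial_fun 1 (fun k => c%:R * k%:R + 1).
  exact: polynomial_funD (polynomial_funZ _ polynomial_fun_id) (polynomial_fun_cst _ 1).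
have pG : polynomial_fun e.+2 G.
  have pLT := @polynomial_fun_prod 'I_e
    (fun i k => (t (widen_ord (leqnSn e) i))%:R * k%:R + 1) (fun=> linear _).
  have pLS := @polynomial_fun_prod 'I_e.+1 (fun i k => (s i)%:R * k%:R + 1)
    (fun=> linear _).
  have pC := @polynomial_fun_sum_prod 'I_e.+1 (fun i => (w i)%:R)
    (fun i => (s i)%:R - (w i)%:R).
  rewrite !card_ord in pLT pLS pC.
  have pV : polynomial_fun 2 V.
    apply: polynomial_funD; first exact/polynomial_funZ/polynomial_fun_sum_pow.
    exact/polynomial_funZ/(polynomial_funW _ polynomial_fun_id).
  apply: polynomial_funD; last exact/polynomial_funZ/polynomial_funX.
  apply: polynomial_funD; last exact: polynomial_funW pLS.
  by apply: polynomial_funD pC; exact: polynomial_funM pV pLT.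
have A'_neq0 : A / q.+1%:R != 0 by rewrite mulf_neq0 // invr_eq0 pnatr_eq0.
apply: (@has_period_sequence_single _ _ _ _ e.+1 (A / q.+1%:R) G) => // k k_gt0.
pose M := (q * k + k + k + k %/ q.+1)%N.
exists (\sum_(Y < M.+1) \prod_i (row_length q w s k i Y).+1)%N; split.
  apply: card_tower_points => // [Y|i Y x _]; first exact: le_height.
  exact: le_row_length.
have := congr1 (fun a => a%:R : rat) (sum_row_lengths q_gt0 w s k).
rewrite -/M; move: (\sum_(Y < M.+1) _)%N => N.
have LSE : (\prod_i (s i * k).+1)%N%:R = LS k.
  by rewrite natr_prod; apply: eq_bigr => i _; rewrite -natr1 natrM.
have LTE : (\prod_(i | i != ord_max) (w i * k).+1)%N%:R = LT k.
  rewrite big_mkcond big_ord_recr /= eqxx muln1 natr_prod; apply: eq_bigr => i _.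
  have im : widen_ord (leqnSn e) i != ord_max.
    by rewrite -val_eqE /= ltn_eqF.
  by rewrite im /w (negbTE im) -natr1 natrM.
have CE : (\sum_(j < k) \prod_i ((k - j) * w i + j * s i).+1)%N%:R = C k.
  rewrite natr_sum; apply: eq_bigr => j _; rewrite natr_prod; apply: eq_bigr => i _.
  by rewrite -natr1 natrD !natrM natrB ?(ltnW (ltn_ord j)) //; ring.
have VE : (q.+2 * 'C(k, 2) + q.+3 * k)%N%:R = V k.
  rewrite natrD !natrM /V -bin2_sum big_mkord natr_sum; congr (_ * _ + _).
have LTk : LT k = \prod_i ((t i)%:R * k%:R + 1).
  by rewrite big_ord_recr /= t_last mul0r add0r mulr1.
have fE : (k %/ q.+1)%:R = (k%:R - (k %% q.+1)%:R) / q.+1%:R :> rat.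
  by rewrite {2}(divn_eq k q.+1) natrD addrK natrM mulfK // pnatr_eq0.
rewrite 2!natrD natrD natrM [(_.+1 * _)%:R]natrM -[(k %/ q.+1).+1%:R]natr1.
rewrite natrM LSE LTE CE VE => NE.
(* The prism gains [k %/ q.+1] copies of S and the notches lose as many copies of T', so the floor
   multiplies [LS k - LT k]. *)
have -> : N%:R = V k * LT k + C k + LS k + (k %/ q.+1)%:R * (LS k - LT k).
  by rewrite -[LHS](addrK ((k %/ q.+1)%:R * LT k)) NE; ring.
have -> : LS k - LT k = A * k%:R ^+ e.+1 by rewrite LTk; exact: AE.
rewrite fE /G [k%:R ^+ e.+2]exprS; move: (k%:R ^+ e.+1 : rat) => x.
by move: (k %% q.+1)%:R (q.+1%:R^-1 : rat) => r u; ring.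
Qed.

Theorem theorem4p1 (R : realType) (p n : nat) (hp : (0 < p)%N) (hn : (3 <= n)%N)
    (s t : nat -> int)
    (hs : forall i : nat, (1 <= i <= n - 1)%N -> 0 < s i)
    (ht : forall j : nat, (1 <= j <= n - 2)%N -> 0 < t j)
    (ht0 : t (n - 1)%N = 0)
    (hst : forall k : nat, (k <= n - 2)%N ->
      \sum_(1 <= i < n) s i ^+ k = \sum_(1 <= j < n) t j ^+ k) :
  exists B : set 'rV[R]_n,
    rational_polytope n B /\
    has_period_sequence B
      (fun i : 'I_n.+1 => if (i == n - 1 :> nat)%N then p else 1%N).
Proof.
(* For p = 1 the cube serves; otherwise the parameter p - 1 of the notches is positive. *)
case: p hp => [//|[|q]] _.
  case: n {hs ht ht0 hst} hn => // d _; have [B [BP Bs]] := cube_period_sequence R d.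
  exists B; split=> //; move: Bs; congr has_period_sequence.
  by apply/funext => i; case: eqP.
case: n hn hs ht ht0 hst => [//|[//|e]] hn; rewrite !subn1 subn2 /= => hs ht ht0 hst.
(* All the sides are nonnegative, so absolute values turn them into naturals; the indices 1, ..., n
   - 1 are shifted to start at 0. *)
pose sn (i : 'I_e.+1) := absz (s i.+1); pose tn (i : 'I_e.+1) := absz (t i.+1).
have sE i : (sn i)%:Z = s i.+1.
  by rewrite /sn gez0_abs // ltW // hs //= ltn_ord.
have t_gt0 (i : 'I_e.+1) : i != ord_max -> 0 < t i.+1.
  rewrite -val_eqE /= => im; apply: ht => //=.
  by rewrite ltn_neqAle im -ltnS ltn_ord.
have tE i : (tn i)%:Z = t i.+1.
  rewrite /tn gez0_abs //; have [->|/t_gt0/ltW//] := eqVneq i ord_max.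
  by rewrite ht0.
apply: (@notched_tower_period_sequence R q.+1 e sn tn) => //.
- by move=> i; rewrite -ltz_nat sE hs //= ltn_ord.
- by move=> i /t_gt0; rewrite -tE ltz_nat.
- by rewrite /tn ht0.
move=> j /andP[_ le_je]; have := hst j le_je.
rewrite !big_add1 !big_mkord /= => E; apply/eqP; rewrite -eqz_nat; apply/eqP.
rewrite -!natz !natr_sum.
under eq_bigr do rewrite natrX natz sE.
by under [RHS]eq_bigr do rewrite natrX natz tE.
Qed.
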